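(* Let $(E,[\![\cdot,\cdot]\!],\rho)$ be a Lie algebroid of rank $m$ over a manifold $Q$ of dimension $n$, let $\eta$ be the canonical contact section of $\mathcal{T}^E(E^*\times\mathbb{R})$ with Reeb section $\mathcal{R}$, and let $H:E^*\times\mathbb{R}\to\mathbb{R}$ be a Hamiltonian function. Then there exists a unique section $\xi_H:E^*\times\mathbb{R}\to\mathcal{T}^E(E^*\times\mathbb{R})$ of $\widetilde\tau_{E^*\times\mathbb{R}}$ (called the Hamiltonian section) satisfying $$\imath_{\xi_H}\eta=-H,\qquad \imath_{\xi_H}\mathrm{d}\eta=\mathrm{d}H-\rho^{*\pi}(\mathcal{R})(H)\,\eta .$$ Moreover, if $\widetilde c:\mathbb{R}\to E^*\times\mathbb{R}$, $\widetilde c(t)=(c^i(t),c_\alpha(t),c_s(t))$ in local coordinates $(q^i,y_\alpha,s)$, is an integral curve of $\xi_H$, then $\widetilde c$ is a solution of the system (the contact Hamilton equations on Lie algebroids) $$\frac{\mathrm{d}c^i}{\mathrm{d}t}=\rho^i_\alpha\,\frac{\partial H}{\partial y_\alpha}\Big|_{\widetilde c(t)},$$ $$\frac{\mathrm{d}c_\alpha}{\mathrm{d}t}=-\left(\rho^i_\alpha\,\frac{\partial H}{\partial q^i}\Big|_{\widetilde c(t)}+\mathcal{C}^\gamma_{\alpha\beta}\,c_\gamma\,\frac{\partial H}{\partial y_\beta}\Big|_{\widetilde c(t)}+c_\alpha\,\frac{\partial H}{\partial s}\Big|_{\widetilde c(t)}\right),$$ $$\frac{\mathrm{d}c_s}{\mathrm{d}t}=c_\alpha\,\frac{\partial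 H}{\partial y_\alpha}\Big|_{\widetilde c(t)}-H(\widetilde c(t)),$$ where the structure functions $\rho^i_\alpha,\mathcal{C}^\gamma_{\alpha\beta}$ are evaluated at the base point $(c^i(t))$.
   Context: All manifolds and maps are $C^\infty$; repeated indices are summed. Lie algebroids. A Lie algebroid $(E,[\![\cdot,\cdot]\!],\rho)$ over $Q$ is a vector bundle $\tau:E\to Q$ with a Lie bracket $[\![\cdot,\cdot]\!]$ on its sections $Sec(E)$ and a vector bundle map $\rho:E\to TQ$ (anchor) such that $[\![\sigma_1,f\sigma_2]\!]=f[\![\sigma_1,\sigma_2]\!]+(\rho(\sigma_1)f)\sigma_2$ for $f\in C^\infty(Q)$. In local coordinates $(q^i)$ on $Q$ and a local basis $\{e_\alpha\}$ of $Sec(E)$, the structure functions are defined by $\rho(e_\alpha)=\rho^i_\alpha\,\partial/\partial q^i$, $[\![e_\alpha,e_\beta]\!]=\mathcal{C}^\gamma_{\alpha\beta}e_\gamma$. The exterior differential $\mathrm{d}^E:Sec(\bigwedge^kE^* )\to Sec(\bigwedge^{k+1}E^* )$ is $\mathrm{d}^E\mu(\sigma_1,\dots,\sigma_{k+1})=\sum_i(-1)^{i+1}\rho(\sigma_i)\mu(\dots,\widehat{\sigma_i},\dots)+\sum_{i<j}(-1)^{i+j}\mu([\![\sigma_i,\sigma_j]\!],\dots,\widehat{\sigma_i},\dots,\widehat{\sigma_j},\dots)$. A contact section on a Lie algebroid $A$ of rank $2k+1$ is a section $\eta$ of $A^*$ with $\eta\wedge(\mathrm{d}^A\eta)^k\neq0$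 everywhere; its Reeb section $\mathcal{R}\in Sec(A)$ is the unique section with $\imath_{\mathcal{R}}\mathrm{d}^A\eta=0$, $\imath_{\mathcal{R}}\eta=1$. Prolongation. Let $E^*$ be the dual bundle of $E$ and $\pi:E^*\times\mathbb{R}\to Q$, $\pi(b^*_q,s)=q$. $\mathcal{T}^E(E^*\times\mathbb{R})$ is the vector bundle $\widetilde\tau_{E^*\times\mathbb{R}}:\mathcal{T}^E(E^*\times\mathbb{R})\to E^*\times\mathbb{R}$ whose fibre over $(b^*_q,s)$ is $\{(a_q,v)\in E_q\times T_{(b^*_q,s)}(E^*\times\mathbb{R}):\rho(a_q)=T\pi(v)\}$. Let $(q^i,y_\alpha,s)$ be the coordinates on $E^*\times\mathbb{R}$ induced by $(q^i)$ and the dual basis $\{e^\alpha\}$. A local basis of sections is $\widetilde{\mathcal{X}}_\alpha(b^*_q,s)=(e_\alpha(q),\rho^i_\alpha(q)\,\partial/\partial q^i|_{(b^*_q,s)})$, $\widetilde{\mathcal{V}}_\alpha(b^*_q,s)=(0_q,\partial/\partial y_\alpha|_{(b^*_q,s)})$, $\widetilde{\mathcal{V}}_s(b^*_q,s)=(0_q,\partial/\partial s|_{(b^*_q,s)})$, with dual basis $\widetilde{\mathcal{X}}^\alpha,\widetilde{\mathcal{V}}^\alpha,\widetilde{\mathcal{V}}^s$. It is a Lie algebroid over $E^*\times\mathbb{R}$ with anchor $\rho^{*\pi}(a_q,v)=v$ and bracket determined by $[\![\widetilde{\mathcal{X}}_\alpha,\widetilde{\mathcal{X}}_\beta]\!]^{*\pi}=\mathcal{C}^\gamma_{\alpha\beta}\widetilde{\mathcal{X}}_\gamma$,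 all other brackets of basis sections being zero. Write $\mathrm{d}$ for its exterior differential; $\widetilde{\mathcal{V}}^s=\mathrm{d}s$. Canonical contact section. $\Theta_{(b^*_q,s)}(a_q,v)=b^*_q(a_q)$ and $\eta=\widetilde{\mathcal{V}}^s-\Theta$ (locally $\eta=\widetilde{\mathcal{V}}^s-y_\alpha\widetilde{\mathcal{X}}^\alpha$). $\eta$ is a contact section of $\mathcal{T}^E(E^*\times\mathbb{R})$, with Reeb section $\mathcal{R}=\widetilde{\mathcal{V}}_s$. An integral curve of a section $\xi$ of $\mathcal{T}^E(E^*\times\mathbb{R})$ is an integral curve of the vector field $\rho^{*\pi}(\xi)$ on $E^*\times\mathbb{R}$. *)

(* Defs.v *)
From HB Require Import structures.
From mathcomp Require Import all_boot all_order all_algebra.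
From mathcomp Require Import all_classical all_reals all_analysis.
Import Order.TTheory GRing.Theory Num.Theory.
Import numFieldNormedType.Exports.

Set Implicit Arguments.
Unset Strict Implicit.
Unset Printing Implicit Defensive.

Local Open Scope classical_set_scope.
Local Open Scope ring_scope.

Definition pickopt (T : Type) (P : set T) : option T :=
  if pselect (exists x, P x) is left h then Some (projT1 (cid h)) else None.

Section Calculus.
Context {R : realType} {N : nat}.
Implicit Types (f : 'rV[R]_N -> R) (U : set 'rV[R]_N).

Definition pder f (i : 'I_N) : 'rV[R]_N -> R := fun x => 'D_(delta_mx 0 i) f x.

Definition iter_pder (s : seq 'I_N) f : 'rV[R]_N -> R :=
  foldr (fun i g => pder g i) f s.

(* Meaningful for U open. *)
Definition smooth_on U f : Prop :=
  forall (s : seq 'I_N) x, U x ->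
    {for x, continuous (iter_pder s f)} /\
    forall i : 'I_N, derivable (iter_pder s f) x (delta_mx 0 i).

End Calculus.

(* A manifold is a type with an atlas of R^n-valued charts; its topology is the
   one induced by the atlas (mopen below). *)

Record chart (R : realType) (M : Type) (n : nat) := Chart {
  cdom : set M;
  cmap : M -> 'rV[R]_n }.

Section Manifold.
Context {R : realType} {M : Type} {n : nat}.
Implicit Types (A : set (chart R M n)) (c : chart R M n) (W : set M).

(* The local expression f o c^-1, set to 0 outside the image of the chart. *)
Definition crep c (f : M -> R) : 'rV[R]_n -> R :=
  fun x => oapp f 0 (pickopt [set p | cdom c p /\ cmap c p = x]).

(* The value at p of the i-th partial derivative of f in the coordinates c. *)
Definition cpder c (f : M -> R) (i : 'I_n) (p : M) : R :=
  pder (crep c f) i (cmap c p).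

Definition is_chart c : Prop :=
  (forall p q, cdom c p -> cdom c q -> cmap c p = cmap c q -> p = q) /\
  open (cmap c @` cdom c).

Definition compatible c c' : Prop :=
  open (cmap c @` (cdom c `&` cdom c')) /\
  forall j : 'I_n, smooth_on (cmap c @` (cdom c `&` cdom c'))
                             (crep c (fun p => cmap c' p 0 j)).

Definition mopen A W : Prop :=
  forall c, A c -> open (cmap c @` (W `&` cdom c)).

(* Meaningful for W open. *)
Definition smooth_fun A W (f : M -> R) : Prop :=
  forall c, A c -> smooth_on (cmap c @` (W `&` cdom c)) (crep c f).

(* A is a differentiable structure of dimension n on M: a maximal smooth atlas
   whose induced topology is Hausdorff and second countable. *)
Record is_manifold A : Prop := IsManifold {
  mfd_chart : forall c, A c -> is_chart c;
  mfd_cover : forall p, exists2 c, A c & cdom c p;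
  mfd_compat : forall c c', A c -> A c' -> compatible c c';
  mfd_max : forall c, is_chart c ->
    (forall c', A c' -> compatible c c' /\ compatible c' c) -> A c;
  mfd_hausdorff : forall p q, p <> q -> exists U V,
    [/\ mopen A U, mopen A V, U p, V q & U `&` V = set0];
  mfd_second_countable : exists B : set (chart R M n),
    [/\ countable B, B `<=` A & forall p, exists2 c, B c & cdom c p] }.

(* A tangent vector at p is the family of its components in all the charts
   around p, these being related by the Jacobian matrices of the changes of
   coordinates; the family is 0 at the charts that are not charts around p. *)
Definition is_tvec A (p : M) (v : chart R M n -> 'rV[R]_n) : Prop :=
  (forall c, ~ (A c /\ cdom c p) -> v c = 0) /\
  (forall c c', A c -> A c' -> cdom c p -> cdom c' p ->
    v c' = v c *m \matrix_(i, j) cpder c (fun q => cmap c' q 0 j) i p).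

Definition tvec_pred A (p : M) : {pred chart R M n -> 'rV[R]_n} :=
  fun v => `[< is_tvec A p v >].

Fact tvec_pred_submod A p : submod_closed (tvec_pred A p).
Proof.
split; first by apply/asboolP; split => // c c' _ _ _ _; rewrite mul0mx.
move=> a v w /asboolP [v0 vJ] /asboolP [w0 wJ]; apply/asboolP; split.
- move=> c nc; have := v0 c nc; have := w0 c nc.
  rewrite /GRing.add /GRing.scale /= => -> ->.
  by rewrite -[LHS]/(a *: 0 + 0) scaler0 addr0.
move=> c c' Ac Ac' cp c'p.
rewrite -[LHS]/(a *: v c' + w c') -[(a *: v + w) c]/(a *: v c + w c).
by rewrite (vJ c c') // (wJ c c') // mulmxDl scalemxAl.
Qed.

HB.instance Definition _ A p :=
  GRing.isSubmodClosed.Build R (chart R M n -> 'rV[R]_n) (tvec_pred A p)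
    (tvec_pred_submod A p).

Record tspace A (p : M) := TVec {
  tval :> chart R M n -> 'rV[R]_n;
  tvalP : tval \in tvec_pred A p }.

HB.instance Definition _ A p := [isSub for @tval A p].
HB.instance Definition _ A p := [Choice of tspace A p by <:].
HB.instance Definition _ A p := [SubChoice_isSubLmodule of tspace A p by <:].

(* The derivative v(f) of a function along a tangent vector, computed in some
   chart around p (all of them give the same value). *)
Definition tapp A p (v : tspace A p) (f : M -> R) : R :=
  oapp (fun c => \sum_(i < n) v c 0 i * cpder c f i p) 0
       (pickopt [set c | A c /\ cdom c p]).

Fact tapp_linear A p (a : R) (v w : tspace A p) f :
  tapp (a *: v + w) f = a * tapp v f + tapp w f.
Proof.
rewrite /tapp; case: pickopt => [c|] /=; last by rewrite mulr0 addr0.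
rewrite mulr_sumr -big_split /=; apply: eq_bigr => i _.
rewrite -[X in X * _]/((a *: tval v c + tval w c) 0 i).
by rewrite !mxE mulrDl mulrA.
Qed.

Definition smooth_vfield A W (X : forall p, tspace A p) : Prop :=
  forall c i, A c -> smooth_fun A (W `&` cdom c) (fun p => X p c 0 i).

(* Defined on the whole of R; smoothness of the curve is automatic when X is a
   smooth vector field. *)
Definition integral_curve A (X : forall p, tspace A p) (g : R -> M) : Prop :=
  forall t c, A c -> cdom c (g t) ->
    (\forall t' \near t, cdom c (g t')) /\
    forall i : 'I_n, is_derive (t : R) (1 : R) (fun t' : R => cmap c (g t') 0 i : R)
                               (X (g t) c 0 i).

End Manifold.

(* w = TF(v), for F : M -> M' and v a tangent vector at p. *)
Definition is_tmap (R : realType) (M M' : Type) (n n' : nat)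
    (A : set (chart R M n)) (A' : set (chart R M' n')) (F : M -> M') (p : M)
    (v : tspace A p) (w : tspace A' (F p)) : Prop :=
  forall c, A' c -> cdom c (F p) ->
    forall i, w c 0 i = tapp v (fun x => cmap c (F x) 0 i).

(* A vector bundle is a family of vector spaces with a set of local frames, i.e.
   local trivialisations. The frames are indexed by a finite type I, the rank
   being #|I|. *)
Record frame (R : realType) (M : Type) (I : finType) (V : M -> lmodType R) :=
  Frame {
    fdom : set M;
    fvec : I -> forall p, V p }.

Definition section (R : realType) (M : Type) (V : M -> lmodType R) :=
  forall p, V p.

Section Bundle.
Context {R : realType} {M : Type} {n : nat} {I : finType} {V : M -> lmodType R}.
Implicit Types (A : set (chart R M n)) (B : set (frame I V)) (e : frame I V).
Implicit Types (s t z : section V) (W : set M).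

Definition is_frame A e : Prop :=
  mopen A (fdom e) /\
  forall p, fdom e p -> forall u : V p,
    exists! x : {ffun I -> R}, u = \sum_(a : I) x a *: fvec e a p.

Definition smooth_section A B W s : Prop :=
  forall e, B e -> exists g : I -> M -> R,
    (forall a, smooth_fun A (W `&` fdom e) (g a)) /\
    (forall p, W p -> fdom e p -> s p = \sum_(a : I) g a p *: fvec e a p).

(* B is the set of all smooth local bases of sections. *)
Record is_vector_bundle A B : Prop := IsVectorBundle {
  vb_frame : forall e, B e -> is_frame A e;
  vb_cover : forall p, exists2 e, B e & fdom e p;
  vb_compat : forall e, B e -> forall a, smooth_section A B (fdom e) (fvec e a);
  vb_max : forall e, is_frame A e ->
    (forall a, smooth_section A B (fdom e) (fvec e a)) -> B e }.

(* (rho(s) f)(p) *)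
Definition anchor_der A (rho : forall p, {linear V p -> tspace A p}) s
    (f : M -> R) (p : M) : R := tapp (rho p (s p)) f.

(* Only the values of br on the smooth global sections are relevant. *)
Record is_lie_algebroid A B (rho : forall p, {linear V p -> tspace A p})
    (br : section V -> section V -> section V) : Prop := IsLieAlgebroid {
  la_anchor_smooth : forall W s, mopen A W -> smooth_section A B W s ->
    smooth_vfield W (fun p => rho p (s p));
  la_closed : forall s t, smooth_section A B setT s ->
    smooth_section A B setT t -> smooth_section A B setT (br s t);
  la_linear : forall (a : R) s t z, smooth_section A B setT s ->
    smooth_section A B setT t -> smooth_section A B setT z ->
    forall p, br (fun q => a *: s q + t q) z p = a *: br s z p + br t z p;
  la_skew : forall s t, smooth_section A B setT s ->
    smooth_section A B setT t -> forall p, br s t p = - br t s p;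
  la_jacobi : forall s t z, smooth_section A B setT s ->
    smooth_section A B setT t -> smooth_section A B setT z ->
    forall p, br s (br t z) p + br t (br z s) p + br z (br s t) p = 0;
  la_leibniz : forall s t f, smooth_section A B setT s ->
    smooth_section A B setT t -> smooth_fun A setT f ->
    forall p, br s (fun q => f q *: t q) p
              = f p *: br s t p + anchor_der rho s f p *: t p }.

(* [[s, t]] = z on W for sections s, t that are only defined on W: the bracket is
   a local operator, and near each point of W its value is that of any two
   global sections which coincide with s and t there. *)
Definition local_bracket A B (br : section V -> section V -> section V) W
    s t z : Prop :=
  forall U s' t', mopen A U -> U `<=` W ->
    smooth_section A B setT s' -> smooth_section A B setT t' ->
    (forall p, U p -> s' p = s p) -> (forall p, U p -> t' p = t p) ->
    forall p, U p -> br s' t' p = z p.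

(* C g a b is the function C^g_{a b}. *)
Definition structure_functions A B (br : section V -> section V -> section V) e
    (C : I -> I -> I -> M -> R) : Prop :=
  forall a b, local_bracket A B br (fdom e) (fvec e a) (fvec e b)
                (fun p => \sum_(g : I) C g a b p *: fvec e g p).

(* The exterior differential in degrees 0 and 1, the only ones needed. *)
Definition ext_d0 A (rho : forall p, {linear V p -> tspace A p}) (f : M -> R)
    s (p : M) : R := anchor_der rho s f p.

Definition ext_d1 A (rho : forall p, {linear V p -> tspace A p})
    (br : section V -> section V -> section V) (mu : forall p, V p -> R)
    s t (p : M) : R :=
  anchor_der rho s (fun q => mu q (t q)) p
  - anchor_der rho t (fun q => mu q (s q)) p
  - mu p (br s t p).

Definition is_reeb A B (rho : forall p, {linear V p -> tspace A p})
    (br : section V -> section V -> section V) (eta : forall p, V p -> R)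
    (r : section V) : Prop :=
  [/\ smooth_section A B setT r,
      forall z, smooth_section A B setT z ->
        forall p, ext_d1 rho br eta r z p = 0
    & forall p, eta p (r p) = 1].

End Bundle.

(* The points (b, s) of E^* x R, b a linear form on the fibre over dr_base. *)
Record dualR (R : realType) (Q : Type) (E : Q -> lmodType R) := DualR {
  dr_base : Q;
  dr_cov : {scalar E dr_base};
  dr_s : R }.

Section Prolongation.
Context {R : realType} {n m : nat} {Q : Type} {E : Q -> lmodType R}.
Implicit Types (A : set (chart R Q n)) (B : set (frame 'I_m E)).
Implicit Types (c : chart R Q n) (e : frame 'I_m E).

Definition dr_pi : dualR E -> Q := @dr_base R Q E.

(* The coordinates (q^i, y_a, s). *)
Definition dr_chart c e : chart R (dualR E) (n + m + 1) :=
  Chart [set p | cdom c (dr_base p) /\ fdom e (dr_base p)]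
        (fun p => row_mx (row_mx (cmap c (dr_base p))
                                 (\row_(a < m) dr_cov p (fvec e a (dr_base p))))
                         (const_mx (dr_s p))).

Definition dr_atlas A B : set (chart R (dualR E) (n + m + 1)) :=
  [set d | exists c e, [/\ A c, B e & d = dr_chart c e]].

Definition idx_q (i : 'I_n) : 'I_(n + m + 1) := lshift 1 (lshift m i).
Definition idx_y (a : 'I_m) : 'I_(n + m + 1) := lshift 1 (rshift n a).
Definition idx_s : 'I_(n + m + 1) := rshift (n + m) ord0.

Section Fibre.
Variables (A : set (chart R Q n)) (B : set (frame 'I_m E)).
Variable rho : forall q, {linear E q -> tspace A q}.

(* The pairs (a, v) with rho(a) = T pi (v). *)
Definition prol_pred (p : dualR E) :
    {pred E (dr_pi p) * tspace (dr_atlas A B) p} :=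
  fun u => `[< is_tmap (F := dr_pi) u.2 (rho (dr_pi p) u.1) >].

Fact prol_pred_submod p : submod_closed (@prol_pred p).
Proof.
have tapp0 f : tapp (0 : tspace (dr_atlas A B) p) f = 0.
  have := tapp_linear (-1) (0 : tspace (dr_atlas A B) p) 0 f.
  by rewrite scaler0 addr0 mulN1r addNr.
split.
  apply/asboolP => c _ _ i /=; rewrite linear0 tapp0.
  by have -> : tval (0 : tspace A (dr_pi p)) c = 0 by []; rewrite mxE.
move=> k u w /asboolP hu /asboolP hw; apply/asboolP => c Ac cp i /=.
rewrite linearP tapp_linear -(hu c Ac cp i) -(hw c Ac cp i).
have -> : forall v v' : tspace A (dr_pi p),
  tval (k *: v + v') c = k *: tval v c + tval v' c by [].
by rewrite !mxE.
Qed.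

HB.instance Definition _ p :=
  GRing.isSubmodClosed.Build R (E (dr_pi p) * tspace (dr_atlas A B) p)%type
    (@prol_pred p) (prol_pred_submod p).

Record prol (p : dualR E) := Prol {
  pval :> E (dr_pi p) * tspace (dr_atlas A B) p;
  pvalP : pval \in @prol_pred p }.

HB.instance Definition _ p := [isSub for @pval p].
HB.instance Definition _ p := [Choice of prol p by <:].
HB.instance Definition _ p := [SubChoice_isSubLmodule of prol p by <:].

Definition prol_anchor_fun p (u : prol p) : tspace (dr_atlas A B) p := (pval u).2.

Fact prol_anchor_linear p : linear (@prol_anchor_fun p).
Proof. by move=> k u w. Qed.

HB.instance Definition _ p :=
  GRing.isLinear.Build R (prol p) (tspace (dr_atlas A B) p) _
    (@prol_anchor_fun p) (@prol_anchor_linear p).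

Definition prol_anchor p : {linear prol p -> tspace (dr_atlas A B) p} :=
  @prol_anchor_fun p.

End Fibre.

(* inl (inl a), inl (inr a) and inr tt stand for X_a, V_a and V_s. *)
Definition prol_idx : finType := ('I_m + 'I_m + unit)%type.

Section Structure.
Variables (A : set (chart R Q n)) (B : set (frame 'I_m E)).
Variable rho : forall q, {linear E q -> tspace A q}.
Local Notation AD := (dr_atlas A B).
Local Notation P := (prol B rho : dualR E -> lmodType R).

(* The element (a, v) of the fibre over p, where v is the tangent vector whose
   components in the chart d are x; such a v is unique. *)
Definition prol_elt (p : dualR E) (d : chart R (dualR E) (n + m + 1))
    (a : E (dr_pi p)) (x : 'rV[R]_(n + m + 1)) : P p :=
  odflt 0 (pickopt [set u : P p | (pval u).1 = a /\ tval (pval u).2 d = x]).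

Definition prol_frame c e : frame prol_idx P :=
  Frame (cdom (dr_chart c e))
    (fun k p =>
      match k with
      | inl (inl a) => prol_elt (dr_chart c e) (fvec e a (dr_pi p))
          (\sum_(i < n) rho (dr_pi p) (fvec e a (dr_pi p)) c 0 i
                        *: delta_mx 0 (idx_q i))
      | inl (inr a) => prol_elt (dr_chart c e) 0 (delta_mx 0 (idx_y a))
      | inr _ => prol_elt (dr_chart c e) 0 (delta_mx 0 idx_s)
      end).

Definition prol_frames : set (frame prol_idx P) :=
  [set f | exists c e, [/\ A c, B e & f = prol_frame c e]].

(* brP is the Lie algebroid bracket of the prolongation, which is determined by
   the brackets of the sections X_a, V_a and V_s. *)
Record is_prol_bracket (br : section E -> section E -> section E)
    (brP : section P -> section P -> section P) : Prop := IsProlBracket {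
  prol_lie_algebroid :
    is_lie_algebroid prol_frames (prol_anchor B rho) brP;
  prol_basis_bracket : forall c e C, A c -> B e ->
    structure_functions A B br e C ->
    forall k l : prol_idx,
      local_bracket AD prol_frames brP (fdom (prol_frame c e))
        (fvec (prol_frame c e) k) (fvec (prol_frame c e) l)
        (fun p => match k, l with
          | inl (inl a), inl (inl b) =>
              \sum_(g < m) C g a b (dr_pi p)
                           *: fvec (prol_frame c e) (inl (inl g)) p
          | _, _ => 0
          end) }.

Definition liouville (p : dualR E) (u : P p) : R := dr_cov p (pval u).1.

(* V^s - Theta, with V^s = ds. *)
Definition contact_eta (p : dualR E) (u : P p) : R :=
  tapp (prol_anchor B rho p u) (@dr_s R Q E) - liouville u.

Record is_hamiltonian_section (brP : section P -> section P -> section P)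
    (r : section P) (H : dualR E -> R) (xi : section P) : Prop :=
  IsHamiltonianSection {
    ham_smooth : smooth_section AD prol_frames setT xi;
    ham_eta : forall p, contact_eta (xi p) = - H p;
    ham_deta : forall z : section P, smooth_section AD prol_frames setT z ->
      forall p, ext_d1 (prol_anchor B rho) brP contact_eta xi z p
        = ext_d0 (prol_anchor B rho) H z p
          - anchor_der (prol_anchor B rho) r H p * contact_eta (z p) }.

End Structure.
End Prolongation.

Notation prol_section B rho := (section (prol B rho : dualR _ -> lmodType _)).

Arguments prol_frames {R n m Q E A} B rho.
Arguments contact_eta {R n m Q E A} B rho p u.

(* Main.v *)
Require Import Defs.
From HB Require Import structures.
From mathcomp Require Import all_boot all_order all_algebra.
From mathcomp Require Import all_classical all_reals all_analysis.
From mathcomp Require Import ring.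
Import Order.TTheory GRing.Theory Num.Theory.
Import numFieldNormedType.Exports.
Set Implicit Arguments.
Unset Strict Implicit.
Unset Printing Implicit Defensive.
Local Open Scope classical_set_scope.
Local Open Scope ring_scope.

(** Over a chart of Q and a local frame e_a of E, the sections X_a, V_a, V_s
    form a frame of the prolongation, eta is V^s - y_a X^a, and the brackets
    of this frame give
      d eta = X^a /\ V^a + (1/2) y_g C^g_ab X^a /\ X^b
    ([deta_formula]). Consequently i_xi (d eta) determines the components of
    xi along X_a and V_a, and eta(xi) = - H then determines the one along V_s.
    Evaluating the defining equation on V_a and on X_a produces exactly the
    right-hand sides of the contact Hamilton equations, while on V_s it reads
    0 = 0 because the Reeb section is V_s ([reeb_frame], [ham_pointP]). So at
    each point there is exactly one vector with the required properties. These
    properties mention no chart, hence the vectors found in the various charts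
    agree; their components are smooth functions, hence they form a smooth
    section. The equations for the integral curves are the components of the
    anchor of this section.

    The equation for xi involves global sections only, whereas the frame is
    local. Since the exterior derivative of a one-form is linear over smooth
    functions, its value at p depends only on the values at p of the two
    sections, and it may be computed on a local frame multiplied by a function
    that is 1 near p and has its support in the domain of the frame
    ([ext_d1_frame]). Such functions are built on Q, where Hausdorffness makes
    the extension by 0 of a compactly supported function smooth
    ([manifold_bump]), and pulled back to E* x R. They also show that the
    bracket of E is local, so that smooth structure functions exist for every
    frame ([structure_functions_exist]).

    Smoothness is the existence and continuity of all iterated partial
    derivatives. A function with continuous partial derivatives is
    differentiable, which yields the chain rule ([is_derive_comp_pder]); the
    stability of smoothness under algebraic operations and composition then
    follows by coinduction ([smooth_on_coind], [smooth_gen_on]), and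
    with it the independence of all the notions from the choice of a chart. *)

(** * Functions with continuous partial derivatives *)

Lemma derive_line (K : numFieldType) (V W : normedModType K) (f : V -> W) (x v : V) :
  'D_v f x = 'D_1 (fun h : K => f (h *: v + x)) 0.
Proof.
rewrite /derive; set g1 := fun h => h^-1 *: _; set g2 := fun h => h^-1 *: _.
suff -> : g1 = g2 by [].
by rewrite funeqE /g1 /g2 => h /=; rewrite addr0 scale0r add0r [_%:A]mulr1.
Qed.

Section C1.
Context {R : realType}.

Lemma is_derive_line (V : normedModType R) (f : V -> R) (y v : V) (t : R) :
  derivable f (y + t *: v) v ->
  is_derive (t : R) (1 : R) (fun s : R => f (y + s *: v) : R)
    ('D_v f (y + t *: v)).
Proof.
have E : (fun h : R => h^-1 *: (f (y + (h *: 1 + t) *: v) - f (y + t *: v))) =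
         (fun h : R => h^-1 *: (f (h *: v + (y + t *: v)) - f (y + t *: v))).
  apply/funext => h; congr (_ *: (f _ - _)).
  by rewrite scalerDl [_%:A](mulr1) addrCA.
by move=> fv; apply: DeriveDef; rewrite /derivable /derive /= E.
Qed.

Lemma MVT_line (V : normedModType R) (f : V -> R) (y v : V) (s : R) :
  (forall t : R, `|t| <= `|s| -> derivable f (y + t *: v) v) ->
  exists2 t : R, `|t| <= `|s| & f (y + s *: v) - f y = s * 'D_v f (y + t *: v).
Proof.
move=> dfv; pose g := (fun t : R => f (y + t *: v) : R).
have dg t : `|t| <= `|s| -> is_derive (t : R) (1 : R) g ('D_v f (y + t *: v)).
  by move=> ts; apply: is_derive_line; exact: dfv.
have cg (a b : R) : (forall t, t \in `[a, b] -> `|t| <= `|s|) ->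
    {within `[a, b], continuous g}.
  move=> ab; by apply: derivable_within_continuous => t /ab/dg[].
have g0 : f y = g 0 by rewrite /g scale0r addr0.
case: (leP 0 s) => s0.
  have H t : t \in `[0, s] -> `|t| <= `|s|.
    by rewrite in_itv /= => /andP[t0 ts]; rewrite !ger0_norm.
  have [t ts E] := @MVT_segment _ g (fun t => 'D_v f (y + t *: v)) 0 s s0
    (fun t ts => dg t (H _ (subset_itv_oo_cc ts))) (cg _ _ H).
  by exists t; [exact: H | rewrite g0 E subr0 mulrC].
have H t : t \in `[s, 0] -> `|t| <= `|s|.
  by rewrite in_itv /= => /andP[t0 ts]; rewrite !ler0_norm ?lerN2 // ltW.
have [t ts E] := @MVT_segment _ g (fun t => 'D_v f (y + t *: v)) s 0 (ltW s0)
  (fun t ts => dg t (H _ (subset_itv_oo_cc ts))) (cg _ _ H).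
exists t; first exact: H.
by rewrite g0 -[LHS]opprB E sub0r mulrN opprK mulrC.
Qed.

Lemma norm_coord N (h : 'rV[R]_N) i : `|h 0 i| <= `|h|.
Proof.
rewrite [leRHS]/Num.Def.normr /= mx_normrE.
exact: (le_bigmax _ (fun ij : 'I_1 * 'I_N => `|h ij.1 ij.2|) (0, i)).
Qed.

Lemma norm_rV_le N (h : 'rV[R]_N) (r : R) :
  0 <= r -> (forall i, `|h 0 i| <= r) -> `|h| <= r.
Proof.
move=> r0 hr; rewrite [leLHS]/Num.Def.normr /= mx_normrE.
by apply: bigmax_le => // -[a i] _; rewrite /= ord1.
Qed.

Section differentiable_pder.
Variables (N : nat) (f : 'rV[R]_N -> R) (x : 'rV[R]_N).

Definition sum_pder (h : 'rV[R]_N) : R := \sum_i h 0 i * pder f i x.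

Fact sum_pder_linear : linear sum_pder.
Proof.
move=> k u v; rewrite /sum_pder scaler_sumr -big_split; apply: eq_bigr => i _.
by rewrite !mxE mulrDl -mulrA.
Qed.

HB.instance Definition _ :=
  GRing.isLinear.Build R 'rV[R]_N R _ sum_pder sum_pder_linear.

Hypothesis df : \forall y \near x, forall i, derivable f y (delta_mx 0 i).
Hypothesis cf : forall i, {for x, continuous (pder f i)}.

Lemma sum_pder_continuous : continuous sum_pder.
Proof.
move=> y; rewrite /sum_pder.
have -> : (fun h : 'rV[R]_N => \sum_i h 0 i * pder f i x) =
    \sum_i (fun h : 'rV[R]_N => h 0 i * pder f i x).
  by apply/funext => h; rewrite fct_sumE.
apply: (big_ind (fun g : 'rV[R]_N -> R => {for y, continuous g})).
- exact: cst_continuous.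
- by move=> g g' cg cg'; exact: continuousD.
- move=> i _; apply: continuousM; last exact: cst_continuous.
  exact: coord_continuous.
Qed.

(** The increment of f is a telescoping sum of increments along a single
    coordinate. Each of them is given by the mean value theorem, and the
    continuity of the partial derivatives at x bounds its distance to the
    corresponding term of the differential. *)
Lemma sum_pder_littleo :
  f \o shift x = cst (f x) + sum_pder +o_ (0 : 'rV[R]_N) id.
Proof.
apply/eqaddoP => _/posnumP[e].
pose e' := e%:num / N.+1%:R.
have e'0 : 0 < e' by rewrite divr_gt0.
have : \forall y \near x, (forall i, derivable f y (delta_mx 0 i)) /\
    forall i, `|pder f i y - pder f i x| <= e'.
  near=> y; split; first by near: y; exact: df.
  near: y; apply: filter_forall => i.
  have /cvgrPdist_le/(_ _ e'0) := (cf (i:=i) : pder f i @ x --> pder f i x).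
  by apply: filterS => y; rewrite distrC.
move=> /nbhs_ballP[r /= r0]; rewrite -ball_normE => Hr.
have Hr0 : \forall h \near (0 : 'rV[R]_N), `|h| < r := nbhs0_lt r0.
near=> h => /=.
have hr : `|h| < r.
  by near: h; exact: Hr0.
(* The first k coordinates of w k are those of x + h, the others those of x. *)
pose w (k : nat) : 'rV[R]_N := x + \row_i (if (i < k)%N then h 0 i else 0).
have w0 : w 0%N = x.
  by rewrite /w -[RHS]addr0; congr (_ + _); apply/rowP => i; rewrite !mxE.
have wN : w N = h + x.
  rewrite /w addrC; congr (_ + _); apply/rowP => i.
  by rewrite !mxE ltn_ord.
have wS (k : 'I_N) : w k.+1 = w k + h 0 k *: delta_mx 0 k.
  rewrite /w -addrA; congr (_ + _); apply/rowP => i; rewrite !mxE /=.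
  rewrite ltnS leq_eqVlt -val_eqE /=; case: eqP => [/val_inj ->|_] /=.
    by rewrite ltnn add0r mulr1.
  by rewrite mulr0 addr0.
have step (k : 'I_N) :
    `|f (w k.+1) - f (w k) - h 0 k * pder f k x| <= e' * `|h|.
  have Hb t : `|t| <= `|h 0 k| -> `|x - (w k + t *: delta_mx 0 k)| < r.
    move=> tk; apply: le_lt_trans hr.
    rewrite /w -addrA opprD addNKr normrN; apply: norm_rV_le => // i.
    rewrite !mxE /= -val_eqE /=; case: ltngtP => ik; rewrite ?(mulr0, addr0) ?normr0 //.
      exact: norm_coord.
    by rewrite mulr1 add0r (le_trans tk) // norm_coord.
  rewrite wS; have [t tk ->] := MVT_line (f := f) (y := w k) (v := delta_mx 0 k) (s := h 0 k)
    (fun t tk => (Hr _ (Hb t tk)).1 k).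
  rewrite -mulrBr normrM mulrC ler_pM //; last exact: norm_coord.
  exact: (Hr _ (Hb t tk)).2.
rewrite [X in `|X| <= _](_ : _ =
    \sum_(k < N) (f (w k.+1) - f (w k) - h 0 k * pder f k x)); last first.
  rewrite -[LHS]/(f (h + x) - (f x + sum_pder h)) sumrB -/(sum_pder h) -(big_mkord predT (fun k => f (w k.+1) - f (w k))).
  by rewrite telescope_sumr // wN w0 opprD addrA.
apply: le_trans (ler_norm_sum _ _ _) _.
apply: (@le_trans _ _ (\sum_(k < N) e' * `|h|)); first exact: ler_sum.
rewrite sumr_const card_ord -mulrnAl ler_wpM2r // /e' -mulrnAr.
rewrite ger_pMr // -mulr_natr ler_pdivrMl // mulr1 ler_nat //.
Unshelve. all: by end_near. Qed.

Lemma diff_sum_pder : 'd f x = sum_pder :> ('rV[R]_N -> R).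
Proof. exact/diff_unique/sum_pder_littleo/sum_pder_continuous. Qed.

(** The same equality at a point that is only provably equal to x, as happens
    when f is composed with a curve through x. *)
Lemma diff_sum_pder_at z : z = x -> 'd f z = sum_pder :> ('rV[R]_N -> R).
Proof. by move=> ->; exact: diff_sum_pder. Qed.

Lemma differentiable_pder : differentiable f x.
Proof.
apply/diff_locallyP; rewrite diff_sum_pder; split.
  exact: sum_pder_continuous.
exact: sum_pder_littleo.
Qed.

(** The chain rule in a direction v of an arbitrary space V: restricting phi to
    the line through y directed by v turns it into a composite of
    differentiable maps. *)
Lemma is_derive_comp_pder (V : normedModType R) (phi : V -> 'rV[R]_N)
    (y v : V) (dphi : 'I_N -> R) : phi y = x ->
  (forall i, is_derive y v (fun z => phi z 0 i : R) (dphi i)) ->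
  is_derive y v (f \o phi : V -> R) (\sum_i dphi i * pder f i x).
Proof.
move=> phiy dphiP.
have dline : derivable (fun h : R => phi (h *: v + y)) 0 1.
  apply/derivable_mxP => i j; rewrite ord1.
  have [d _] := dphiP j.
  have K := (derivable1P (fun z => phi z 0 j : R) y v).1 d.
  exact: K.
have Dline : 'D_1 (fun h : R => phi (h *: v + y)) 0 = \row_i dphi i.
  rewrite derive_mx //; apply/matrixP => i j; rewrite ord1 !mxE.
  have [_ <-] := dphiP j.
  by rewrite [RHS]derive_line.
have dline' := (derivable1_diffP _ _).1 dline.
have phi0 : phi (0 *: v + y) = x by rewrite scale0r add0r.
have df' : differentiable f (phi (0 *: v + y)).
  by rewrite phi0; exact: differentiable_pder.
have dcomp := differentiable_comp dline' df'.
have dfphi := (derivable1P (f \o phi) y v).2 (diff_derivable dcomp).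
apply: DeriveDef => //.
rewrite (derive_line (f \o phi)) deriveE //.
have E := congr1 (fun g : R -> R => g 1) (diff_comp dline' df').
apply: etrans E _ => /=.
rewrite diff_sum_pder_at // -deriveE // Dline /sum_pder.
by apply: eq_bigr => i _; rewrite mxE.
Qed.
End differentiable_pder.
End C1.

(** * Smooth functions on open subsets of R^N *)

Section SmoothOn.
Context {R : realType}.

Section Base.
Context {N : nat}.
Implicit Types (f g : 'rV[R]_N -> R) (U : set 'rV[R]_N).

Lemma open_near_eq U f g x : open U -> (forall x, U x -> f x = g x) -> U x ->
  \near x, f x = g x.
Proof.
by move=> Uo fg Ux; apply: filterS (open_nbhs_nbhs (conj Uo Ux)).
Qed.

Lemma pder_eq U f g i x : open U -> (forall x, U x -> f x = g x) -> U x ->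
  pder f i x = pder g i x.
Proof. by move=> Uo fg Ux; apply/near_eq_derive/(open_near_eq Uo fg Ux). Qed.

Lemma iter_pder_eq U f g s x : open U -> (forall x, U x -> f x = g x) -> U x ->
  iter_pder s f x = iter_pder s g x.
Proof.
move=> Uo fg; elim: s x => [|i s IH] x Ux /=; first exact: fg.
by apply: (pder_eq _ Uo).
Qed.

Lemma continuous_eq U f g x : open U -> (forall x, U x -> f x = g x) -> U x ->
  {for x, continuous f} -> {for x, continuous g}.
Proof.
move=> Uo fg Ux cf P; rewrite /continuous_at -(fg _ Ux) => /cf Pf.
apply: filterS2 (open_near_eq Uo fg Ux) Pf.
by move=> z /= ->.
Qed.

Lemma derivable_eq U f g x v : open U -> (forall x, U x -> f x = g x) -> U x ->
  derivable f x v -> derivable g x v.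
Proof. by move=> Uo fg Ux; apply/near_eq_derivable/(open_near_eq Uo fg Ux). Qed.

Lemma smooth_on_eq U f g : open U -> (forall x, U x -> f x = g x) ->
  smooth_on U f -> smooth_on U g.
Proof.
move=> Uo fg sf s x Ux; have [cf df] := sf s x Ux.
have E y : U y -> iter_pder s f y = iter_pder s g y.
  by move=> Uy; exact: (iter_pder_eq _ Uo).
split; first exact: (continuous_eq Uo E).
by move=> i; apply: (derivable_eq Uo E).
Qed.

Lemma smooth_on_pder U f i : smooth_on U f -> smooth_on U (pder f i).
Proof. by move=> sf s x Ux; have := sf (rcons s i) x Ux; rewrite /iter_pder foldr_rcons. Qed.

Lemma smooth_onS U U' f : U' `<=` U -> smooth_on U f -> smooth_on U' f.
Proof. by move=> U'U sf s x /U'U; exact: sf. Qed.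

Lemma smooth_on_continuous U f x : smooth_on U f -> U x -> {for x, continuous f}.
Proof. by move=> sf Ux; have [] := sf [::] x Ux. Qed.

Lemma smooth_on_derivable U f x i : smooth_on U f -> U x ->
  derivable f x (delta_mx 0 i).
Proof. by move=> sf Ux; have [] := sf [::] x Ux. Qed.

Lemma is_derive_smooth_comp (V : normedModType R) (phi : V -> 'rV[R]_N)
    U f (y v : V) (dphi : 'I_N -> R) : open U -> smooth_on U f -> U (phi y) ->
  (forall i, is_derive y v (fun z => phi z 0 i : R) (dphi i)) ->
  is_derive y v (f \o phi : V -> R) (\sum_i dphi i * pder f i (phi y)).
Proof.
move=> Uo sf Uy dphiP; apply: (@is_derive_comp_pder _ _ _ (phi y)) => //.
  apply: filterS (open_nbhs_nbhs (conj Uo Uy)) => z Uz i.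
  exact: smooth_on_derivable sf Uz.
by move=> i; apply: smooth_on_continuous Uy; exact: smooth_on_pder sf.
Qed.

(** A set of continuous functions that is stable under partial derivatives
    consists of smooth functions. Working with such a set replaces formulas for
    the higher derivatives. *)
Lemma smooth_on_coind (K : set ('rV[R]_N -> R)) U : open U ->
  (forall f, K f -> forall x, U x -> {for x, continuous f}) ->
  (forall f, K f -> forall i, exists2 g, K g &
    forall x, U x -> is_derive x (delta_mx 0 i) f (g x)) ->
  forall f, K f -> smooth_on U f.
Proof.
move=> Uo Kc Kd f Kf s.
have [g Kg E] : exists2 g, K g & forall x, U x -> g x = iter_pder s f x.
  elim: s => [|i s [g Kg E]]; first by exists f.
  have [g' Kg' dg] := Kd g Kg i; exists g' => // x Ux /=.
  have [_ <-] := dg x Ux; exact: (pder_eq _ Uo).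
move=> x Ux; split; first by apply: (continuous_eq Uo E) => //; exact: Kc.
move=> i; apply: (derivable_eq Uo E) => //.
by have [g' _ dg] := Kd g Kg i; have [] := dg x Ux.
Qed.

Lemma smooth_on_cst U (k : R) : open U -> smooth_on U (cst k).
Proof.
move=> Uo.
pose K := [set f : 'rV[R]_N -> R | exists k, f = cst k].
apply: (@smooth_on_coind K) => //; last by exists k.
- by move=> _ [l ->] x _; exact: cst_continuous.
- move=> _ [l ->] i; exists (cst 0); first by exists 0.
  by move=> x _; exact: is_derive_cst.
Qed.

Lemma is_derive_coord (x v : 'rV[R]_N) (j : 'I_N) :
  is_derive x v (fun y : 'rV[R]_N => y 0 j : R) (v 0 j).
Proof.
have d : differentiable (fun y : 'rV[R]_N => y 0 j : R) x.
  exact: differentiable_coord.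
apply: DeriveDef; first exact: diff_derivable.
have dl := derive_mx (@derivable_id R _ x v).
by have := congr1 (fun M : 'rV[R]_N => M 0 j) dl; rewrite mxE derive_id.
Qed.

Lemma smooth_on_coord U j : open U -> smooth_on U (fun y : 'rV[R]_N => y 0 j).
Proof.
move=> Uo.
pose K := [set f : 'rV[R]_N -> R | f = (fun y => y 0 j) \/ exists k, f = cst k].
apply: (@smooth_on_coind K) => //; last by left.
- move=> _ [->|[l ->]] x _; first exact: coord_continuous.
  exact: cst_continuous.
- move=> _ [->|[l ->]] i.
    exists (cst ((delta_mx 0 i : 'rV[R]_N) 0 j)); first by right; eexists.
    by move=> x _; exact: is_derive_coord.
  exists (cst 0); first by right; exists 0.
  by move=> x _; exact: is_derive_cst.
Qed.

End Base.

Section Closure.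
Context {N : nat}.
Implicit Types (U : set 'rV[R]_N).

(** The operations are closed up simultaneously because the derivative of a
    product, of an inverse or of a composite involves several of them; this
    makes the set stable under partial derivatives. *)
Inductive smooth_gen U : ('rV[R]_N -> R) -> Prop :=
| gen_smooth f : smooth_on U f -> smooth_gen U f
| gen_add f g : smooth_gen U f -> smooth_gen U g ->
    smooth_gen U (fun x => f x + g x)
| gen_mul f g : smooth_gen U f -> smooth_gen U g ->
    smooth_gen U (fun x => f x * g x)
| gen_inv f : smooth_gen U f -> (forall x, U x -> f x != 0) ->
    smooth_gen U (fun x => (f x)^-1)
| gen_comp N' (V : set 'rV[R]_N') (phi : 'I_N' -> 'rV[R]_N -> R) g :
    open V -> smooth_on V g -> (forall j, smooth_gen U (phi j)) ->
    (forall x, U x -> V (\row_j phi j x)) ->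
    smooth_gen U (fun x => g (\row_j phi j x)).

Lemma smooth_gen_sum U (J : Type) (r : seq J) (F : J -> 'rV[R]_N -> R) :
  open U -> (forall j, smooth_gen U (F j)) ->
  smooth_gen U (fun x => \sum_(j <- r) F j x).
Proof.
move=> Uo sF; elim: r => [|j r IH].
  have -> : (fun x => \sum_(j <- [::]) F j x) = cst 0.
    by apply/funext => x; rewrite big_nil.
  by constructor; exact: smooth_on_cst.
have -> : (fun x => \sum_(j <- j :: r) F j x) =
    (fun x => F j x + \sum_(j <- r) F j x).
  by apply/funext => x; rewrite big_cons.
exact: gen_add.
Qed.

Lemma continuous_row N' (phi : 'I_N' -> 'rV[R]_N -> R) (x : 'rV[R]_N) :
  (forall j, {for x, continuous (phi j)}) ->
  {for x, continuous (fun x => \row_j phi j x : 'rV[R]_N')}.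
Proof.
move=> cphi A [P PA] AP.
have K j : \forall y \near x, P 0 j (phi j y).
  have cj : phi j @ x --> phi j x := cphi j.
  by apply: cj; have := PA 0 j; rewrite mxE.
have K' : \forall y \near x, forall j, P 0 j (phi j y) := filter_forall (nbhs_filter x) K.
apply: (@filterS _ (nbhs x)) K' => y Py; apply: AP => i j.
by rewrite ord1 mxE.
Qed.

Lemma smooth_gen_continuous U f : smooth_gen U f ->
  forall x, U x -> {for x, continuous f}.
Proof.
elim=> {f}.
- by move=> f sf x Ux; exact: smooth_on_continuous sf Ux.
- by move=> f g _ cf _ cg x Ux; apply: continuousD; [exact: cf | exact: cg].
- by move=> f g _ cf _ cg x Ux; apply: continuousM; [exact: cf | exact: cg].
- by move=> f _ cf f0 x Ux; apply: continuousV; [exact: f0 | exact: cf].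
- move=> N' V phi g Vo sg _ cphi UV x Ux.
  apply: (@continuous_comp _ _ _ (fun x => \row_j phi j x) g).
    by apply: continuous_row => j; exact: cphi.
  by apply: smooth_on_continuous sg _; exact: UV.
Qed.

Lemma smooth_gen_derive U f : open U -> smooth_gen U f -> forall i,
  exists2 g, smooth_gen U g &
    forall x, U x -> is_derive x (delta_mx 0 i) f (g x).
Proof.
move=> Uo; elim=> {f}.
- move=> f sf i; exists (pder f i); first by constructor; exact: smooth_on_pder.
  by move=> x Ux; apply: derivableP; exact: smooth_on_derivable sf Ux.
- move=> f g _ Hf _ Hg i; have [f' sf' df] := Hf i; have [g' sg' dg] := Hg i.
  exists (fun x => f' x + g' x); first exact: gen_add.
  by move=> x Ux; apply: is_deriveD; [exact: df | exact: dg].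
- move=> f g sf Hf sg Hg i; have [f' sf' df] := Hf i; have [g' sg' dg] := Hg i.
  exists (fun x => f x * g' x + g x * f' x).
    by apply: gen_add; exact: gen_mul.
  move=> x Ux; have fx := df x Ux; have gx := dg x Ux.
  exact: (is_deriveM fx gx).
- move=> f sf Hf f0 i; have [f' sf' df] := Hf i.
  exists (fun x => (cst (-1) x * (f x)^-1 * (f x)^-1) * f' x).
    apply: gen_mul => //; apply: gen_mul; last exact: gen_inv.
    by apply: gen_mul; [constructor; exact: smooth_on_cst | exact: gen_inv].
  move=> x Ux; have [fx dfx] := df x Ux; apply: DeriveDef.
    by apply: derivableV => //; exact: f0.
  rewrite deriveV //; last exact: f0.
  rewrite dfx /GRing.scale /= mulN1r mulNr.
  by rewrite -exprVn expr2.
- move=> N' V phi g Vo sg sphi Hphi UV i.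
  have [phi' /all_and2[sphi' dphi]] := choice (fun j =>
    let: ex_intro2 g' s d := Hphi j i in ex_intro _ g' (conj s d)).
  exists (fun x => \sum_j phi' j x * pder g j (\row_j phi j x)).
    apply: smooth_gen_sum => // j; apply: gen_mul => //.
    exact: (gen_comp Vo (smooth_on_pder j sg) sphi UV).
  move=> x Ux.
  apply: (is_derive_smooth_comp (phi := fun x => \row_j phi j x) Vo sg (UV _ Ux)).
  move=> j; rewrite (_ : (fun _ => _) = phi j); first exact: dphi.
  by apply/funext => z; rewrite mxE.
Qed.

Lemma smooth_gen_on U f : open U -> smooth_gen U f -> smooth_on U f.
Proof.
move=> Uo; apply: smooth_on_coind => //.
  exact: smooth_gen_continuous.
by move=> g sg i; exact: smooth_gen_derive.
Qed.

End Closure.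
End SmoothOn.

(** * The flat function exp (-1/x) *)

Section Flat.
Context {R : realType}.
Implicit Types (p : {poly R}) (x y : R).

(** For p = 1 this is exp (- 1 / x) extended by 0. Polynomials in 1 / x are
    allowed as factors because differentiation produces them, which makes the
    family stable under derivatives. *)
Definition flat p x : R := if 0 < x then p.[x^-1] * expR (- x^-1) else 0.

Lemma flat_le0 p x : x <= 0 -> flat p x = 0.
Proof. by rewrite /flat ltNge => ->. Qed.

Lemma flat1_gt0 x : 0 < x -> 0 < flat 1 x.
Proof. by move=> x0; rewrite /flat x0 hornerC mul1r expR_gt0. Qed.

Lemma flat1_ge0 x : 0 <= flat 1 x.
Proof.
by case: (ltP 0 x) => x0; [rewrite ltW // flat1_gt0 | rewrite flat_le0].
Qed.

(** A term of the exponential series bounds exp y from below. The two powers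
    of y in excess of n make [flat p] quadratically small at 0, hence
    differentiable there. *)
Lemma exprn_expRN_le n y : 0 < y -> y ^+ n * expR (- y) <= n.+2`!%:R * y^-1 ^+ 2.
Proof.
move=> y0; rewrite expRN ler_pdivrMr ?expR_gt0 // mulrC.
have f0 : 0 < n.+2`!%:R :> R by rewrite ltr0n fact_gt0.
have := expR_ge1Dxn n.+1 (ltW y0) => H.
have {}H : y ^+ n.+2 / n.+2`!%:R <= expR y.
  by apply: le_trans H; rewrite ler_wpDl.
apply: le_trans (ler_wpM2r _ H); last first.
  by rewrite mulr_ge0 // ?exprn_ge0 ?invr_ge0 // ltW.
rewrite mulrA divfK ?gt_eqF // -addn2 exprD -mulrA -exprMn mulfV ?gt_eqF //.
by rewrite expr1n mulr1.
Qed.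

Lemma flat_le_sqr p : exists2 C, 0 <= C & forall x, `|flat p x| <= C * x ^+ 2.
Proof.
exists (\sum_(i < size p) `|p`_i| * i.+2`!%:R).
  by apply: sumr_ge0 => i _; rewrite mulr_ge0.
move=> x; case: (ltP 0 x) => x0; last first.
  rewrite flat_le0 // normr0 mulr_ge0 ?sqr_ge0 //.
  by apply: sumr_ge0 => i _; rewrite mulr_ge0.
rewrite /flat x0 horner_coef mulr_suml mulr_suml.
apply: le_trans (ler_norm_sum _ _ _) _; apply: ler_sum => i _.
rewrite -mulrA normrM -mulrA ler_wpM2l // ger0_norm; last first.
  by rewrite mulr_ge0 ?expR_ge0 // exprn_ge0 // invr_ge0 ltW.
have := @exprn_expRN_le i x^-1; rewrite invr_gt0 => /(_ x0).
by rewrite invrK.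
Qed.

Lemma is_derive_flat p x : is_derive x 1 (flat p) (flat ('X^2 * (p - p^`())) x).
Proof.
case: (ltgtP 0 x) => x0.
- pose g := (fun y : R => p.[y] * expR (- y)) \o (fun y => y^-1).
  apply: (@near_eq_is_derive _ _ _ g).
    apply: filterS (lt_nbhsr x0) => y y0.
    by rewrite /g /flat /= y0.
  have dV : is_derive x 1 (fun y : R => y^-1) (- x^-1 ^+ 2).
    have := @is_deriveV R id x 1 1 (lt0r_neq0 x0) (is_derive_id _ _).
    by rewrite /= => H; apply: is_derive_eq; rewrite /GRing.scale /= mulr1 exprVn.
  have dg : is_derive x^-1 1 (fun y : R => p.[y] * expR (- y))
      (p^`().[x^-1] * expR (- x^-1) - p.[x^-1] * expR (- x^-1)).
    have d1 : is_derive x^-1 1 (fun y : R => expR (- y)) (- expR (- x^-1)).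
      have := @is_derive1_comp R expR -%R x^-1 _ _ (is_derive_expR _) (is_deriveNid _ _).
      by rewrite mulrN1.
    have := is_deriveM (is_derive_poly p x^-1) d1.
    move=> H; apply: is_derive_eq.
    by rewrite /GRing.scale /= mulrN addrC mulrC.
  have := is_derive1_comp dg dV => H.
  apply: is_derive_eq; rewrite /flat x0 hornerM hornerXn !hornerE.
  ring.
- apply: (@near_eq_is_derive _ _ _ (cst 0)).
    apply: filterS (lt_nbhsl x0) => y y0.
    by rewrite flat_le0 // ltW.
  by rewrite flat_le0 ?ltW //; exact: is_derive_cst.
- rewrite -{x}x0 flat_le0 //; have [C C0 HC] := flat_le_sqr p.
  have lim0 : (fun h : R => h^-1 *: (flat p (h *: 1 + 0) - flat p 0)) @ (0 : R)^' --> (0 : R).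
    apply/cvgrPdist_le => e e0; near=> h.
    have h0 : h != 0 by near: h; exact: nbhs_dnbhs_neq.
    rewrite sub0r normrN addr0 [h%:A]mulr1 (flat_le0 p (lexx 0)) subr0 normrM normfV.
    rewrite ler_pdivrMl ?normr_gt0 //; apply: le_trans (HC h) _.
    rewrite -[h ^+ 2]ger0_norm ?sqr_ge0 // expr2 normrM mulrCA ler_wpM2l //.
    have : `|h| < e / (C + 1).
      by near: h; apply: dnbhs0_lt; rewrite divr_gt0 // ltr_wpDl.
    rewrite ltr_pdivlMr ?ltr_wpDl // => /ltW; apply: le_trans.
    by rewrite mulrC ler_wpM2l // lerDl.
  apply: DeriveDef; first by apply/cvg_ex; exists 0.
  exact: cvg_lim.
Unshelve. all: by end_near. Qed.

Lemma continuous_flat p : continuous (flat p).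
Proof.
move=> x; apply/differentiable_continuous/derivable1_diffP.
by have [] := is_derive_flat p x.
Qed.

Lemma smooth_on_flat (p : {poly R}) :
  smooth_on setT (fun x : 'rV[R]_1 => flat p (x 0 0)).
Proof.
pose K := [set f : 'rV[R]_1 -> R | exists p, f = (fun x : 'rV[R]_1 => flat p (x 0 0))].
apply: (@smooth_on_coind _ _ K); [exact: openT| | |by exists p].
- move=> _ [q ->] x _.
  by apply: (@continuous_comp _ _ _ (fun x : 'rV[R]_1 => x 0 0) (flat q));
    [exact: coord_continuous | exact: continuous_flat].
- move=> _ [q ->] i.
  exists (fun x : 'rV[R]_1 => flat ('X^2 * (q - q^`())) (x 0 0)); first by eexists; reflexivity.
  move=> x _; rewrite ord1.
  have [dq Dq] := is_derive_flat q (x 0 0).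
  have dc : differentiable (fun x : 'rV[R]_1 => x 0 0 : R) x.
    exact: differentiable_coord.
  have dq' : differentiable (flat q) (x 0 0) by exact/derivable1_diffP.
  have E : 'D_(delta_mx 0 0) (fun x : 'rV[R]_1 => x 0 0 : R) x = 1.
    have [_ ->] := @is_derive_coord R 1 x (delta_mx 0 0) 0.
    by rewrite mxE !eqxx.
  apply: DeriveDef; first exact: (diff_derivable (differentiable_comp dc dq')).
  rewrite (deriveE _ (differentiable_comp dc dq')).
  have := congr1 (fun g : 'rV[R]_1 -> R => g (delta_mx 0 0)) (diff_comp dc dq').
  move=> H; apply: etrans H _ => /=.
  by rewrite -(deriveE _ dc) E -(deriveE _ dq') Dq.
Qed.

End Flat.

(** * Bump functions on R^N *)

Section Bump.
Context {R : realType}.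

Definition smooth_step (t : R) : R := flat 1 t / (flat 1 t + flat 1 (1 - t)).

Lemma smooth_step_den (t : R) : 0 < flat 1 t + flat 1 (1 - t).
Proof.
case: (ltP 0 t) => t0.
  by apply: ltr_pwDl; [exact: flat1_gt0 | exact: flat1_ge0].
apply: ltr_wpDl; first exact: flat1_ge0.
by apply: flat1_gt0; rewrite subr_gt0 (le_lt_trans t0).
Qed.

Lemma smooth_step0 (t : R) : t <= 0 -> smooth_step t = 0.
Proof. by move=> t0; rewrite /smooth_step flat_le0 // mul0r. Qed.

Lemma smooth_step1 (t : R) : 1 <= t -> smooth_step t = 1.
Proof.
move=> t1; rewrite /smooth_step (@flat_le0 _ _ (1 - t)) ?subr_le0 // addr0 divff //.
by rewrite gt_eqF // flat1_gt0 // (lt_le_trans ltr01).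
Qed.

Lemma smooth_gen_flat N (U : set 'rV[R]_N) p f :
  smooth_gen U f -> smooth_gen U (fun x => flat p (f x)).
Proof.
move=> sf; rewrite (_ : (fun _ => _) =
    (fun x => (fun y : 'rV[R]_1 => flat p (y 0 0)) (\row_(j < 1) f x))).
  exact: (@gen_comp _ _ U 1 setT (fun _ => f) _ openT (smooth_on_flat p)).
by apply/funext => x; rewrite mxE.
Qed.

Lemma smooth_gen_step N (U : set 'rV[R]_N) f : open U ->
  smooth_gen U f -> smooth_gen U (fun x => smooth_step (f x)).
Proof.
move=> Uo sf; apply: gen_mul; first exact: smooth_gen_flat.
apply: gen_inv; last by move=> x _; rewrite gt_eqF // smooth_step_den.
apply: gen_add; first exact: smooth_gen_flat.
apply: (@smooth_gen_flat _ _ _ (fun x => 1 - f x)).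
rewrite (_ : (fun _ => _) = (fun x => cst 1 x + cst (-1) x * f x)); last first.
  by apply/funext => x; rewrite /= mulN1r.
apply: gen_add; first by constructor; exact: smooth_on_cst.
by apply: gen_mul => //; constructor; exact: smooth_on_cst.
Qed.

Definition sqr_dist N (x0 x : 'rV[R]_N) : R := \sum_i (x 0 i - x0 0 i) ^+ 2.

Lemma smooth_gen_sqr_dist N (U : set 'rV[R]_N) x0 : open U ->
  smooth_gen U (sqr_dist x0).
Proof.
move=> Uo.
have sD i : smooth_gen U (fun x : 'rV[R]_N => x 0 i + cst (- x0 0 i) x).
  apply: gen_add; first by constructor; exact: smooth_on_coord.
  by constructor; exact: smooth_on_cst.
by apply: smooth_gen_sum => // i; apply: gen_mul; exact: sD.
Qed.

Lemma norm_le_sqr_dist N (x0 x : 'rV[R]_N) r : 0 <= r ->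
  sqr_dist x0 x <= r ^+ 2 -> `|x - x0| <= r.
Proof.
move=> r0 Hx; apply: norm_rV_le => // i.
rewrite -(@ler_pXn2r _ 2) ?nnegrE // real_normK ?num_real // !mxE.
apply: le_trans Hx; rewrite /sqr_dist (bigD1 i) //= lerDl.
by apply: sumr_ge0 => j _; exact: sqr_ge0.
Qed.

(** A smooth step applied to the square of the Euclidean distance to x0, which
    is a polynomial. *)
Lemma bump_rV N (V : set 'rV[R]_N) x0 : open V -> V x0 ->
  exists (f : 'rV[R]_N -> R) (K : set 'rV[R]_N),
    [/\ smooth_on setT f, compact K, K `<=` V, forall x, ~ K x -> f x = 0 &
        \forall x \near x0, f x = 1].
Proof.
move=> Vo Vx0.
have : nbhs x0 V by apply: open_nbhs_nbhs; split.
move=> /nbhs_ballP[e /= e0]; rewrite -ball_normE => HV.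
pose r := e / 2; have r0 : 0 < r by rewrite divr_gt0.
have re : r < e by rewrite /r ltr_pdivrMr // ltr_pMr // ltr1n.
pose K := [set x | sqr_dist x0 x <= r ^+ 2].
have cS : continuous (sqr_dist x0).
  move=> x; apply: (smooth_gen_continuous (U := setT)) => //.
  by apply: smooth_gen_sqr_dist; exact: openT.
(* The argument of the step is 1 or more when the squared distance is at most
   r^2 / 2, and 0 or less when it is at least r^2. *)
exists (fun x => smooth_step (2 - 2 / r ^+ 2 * sqr_dist x0 x)), K; split.
- apply: smooth_gen_on; first exact: openT.
  apply: smooth_gen_step; first exact: openT.
  rewrite (_ : (fun _ => _) =
    (fun x => cst 2 x + cst (- (2 / r ^+ 2)) x * sqr_dist x0 x)); last first.
    by apply/funext => x; rewrite /= mulNr.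
  apply: gen_add; first by constructor; apply: smooth_on_cst; exact: openT.
  apply: gen_mul; first by constructor; apply: smooth_on_cst; exact: openT.
  by apply: smooth_gen_sqr_dist; exact: openT.
- apply: bounded_closed_compact.
    exists (r + `|x0|); split; first exact: num_real.
    move=> M rM x Kx; apply/ltW; apply: le_lt_trans rM.
    rewrite -(subrK x0 x); apply: le_trans (ler_normD _ _) _.
    by rewrite lerD2r norm_le_sqr_dist // ltW.
  have -> : K = sqr_dist x0 @^-1` [set y | y <= r ^+ 2] by [].
  by apply: preimage_closed; [move=> x _; exact: cS | exact: closed_le].
- move=> x Kx; apply: HV => /=; rewrite distrC; apply: le_lt_trans re.
  by apply: norm_le_sqr_dist => //; exact: ltW.
- move=> x /negP; rewrite -ltNge => Kx; apply: smooth_step0.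
  rewrite subr_le0 -mulrA ler_pMr // ler_pdivlMl ?exprn_gt0 // mulr1; exact: ltW.
- have : \forall x \near x0, sqr_dist x0 x < r ^+ 2 / 2.
    have Sx0 : sqr_dist x0 x0 = 0.
      by rewrite /sqr_dist big1 // => i _; rewrite subrr expr0n.
    have c0 : sqr_dist x0 @ x0 --> (0 : R) by rewrite -Sx0; exact: cS.
    have h0 : 0 < r ^+ 2 / 2 by rewrite divr_gt0 // exprn_gt0.
    exact: (c0 _ (lt_nbhsl h0)).
  apply: filterS => x Hx; apply: smooth_step1.
  rewrite lerBrDr -lerBrDl (_ : 2 - 1 = 1); last by ring.
  rewrite -mulrA -ler_pdivlMl // mulr1 ler_pdivrMl ?exprn_gt0 //.
  by apply: ltW.
Qed.

End Bump.

(** * Local expressions in a chart *)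

Lemma pickoptP (T : Type) (P : set T) :
  (exists2 x, P x & pickopt P = Some x) \/ ((forall x, ~ P x) /\ pickopt P = None).
Proof.
rewrite /pickopt; case: pselect => [h|h]; last by right; split => // x Px; apply: h; exists x.
by left; exists (projT1 (cid h)) => //; exact: (projT2 (cid h)).
Qed.

Section Chart.
Context {R : realType} {M : Type} {n : nat}.
Implicit Types (A : set (chart R M n)) (c : chart R M n) (f g : M -> R) (p q : M).

Lemma crep_cmap c f p : is_chart c -> cdom c p -> crep c f (cmap c p) = f p.
Proof.
move=> [inj _] cp; rewrite /crep.
have [[q [cq E] ->]|[H _]] := pickoptP [set q | cdom c q /\ cmap c q = cmap c p].
  by rewrite /= (inj _ _ cq cp E).
by case: (H p).
Qed.

(** The topology of M is known only through the images of the charts, so that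
    the neighbourhoods of p are read in a chart. *)
Definition chart_near c p (P : set M) : Prop :=
  \forall x \near cmap c p, forall q, cdom c q -> cmap c q = x -> P q.

Lemma chart_nearT c p (P : set M) : (forall q, P q) -> chart_near c p P.
Proof. by move=> H; rewrite /chart_near; apply: filterE => x q _ _. Qed.

Lemma chart_nearS c p (P P' : set M) : (forall q, cdom c q -> P q -> P' q) ->
  chart_near c p P -> chart_near c p P'.
Proof. by move=> H; rewrite /chart_near; apply: filterS => x Hx q cq xq; apply: H => //; exact: Hx xq. Qed.

Lemma chart_nearI c p (P P' : set M) : chart_near c p P -> chart_near c p P' ->
  chart_near c p (fun q => P q /\ P' q).
Proof. by rewrite /chart_near; apply: filterS2 => x H H' q cq xq; split; [exact: H xq | exact: H' xq]. Qed.

Lemma chart_near_self c p (P : set M) : chart_near c p P -> cdom c p -> P p.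
Proof. by move=> /nbhs_singleton H cp; exact: H. Qed.

(** U is required to lie in the image of the chart because [crep c f] is 0
    elsewhere. *)
Definition chart_smooth c f p : Prop := exists U : set 'rV[R]_n,
  [/\ open U, U (cmap c p), U `<=` cmap c @` cdom c & smooth_on U (crep c f)].

Lemma chart_smooth_intro c f p (U : set 'rV[R]_n) (g : 'rV[R]_n -> R) : is_chart c -> cdom c p ->
  open U -> U (cmap c p) -> smooth_on U g ->
  (forall q, cdom c q -> U (cmap c q) -> f q = g (cmap c q)) -> chart_smooth c f p.
Proof.
move=> hc cp Uo Up sg fg; exists (U `&` cmap c @` cdom c).
have VO : open (U `&` cmap c @` cdom c) by apply: openI => //; have [] := hc.
split; first exact: VO.
- by split=> //; exists p.
- by move=> x [].
apply: (smooth_on_eq (f := g) VO); last by apply: smooth_onS sg => x [].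
by move=> x [Ux [q cq xq]]; rewrite -xq crep_cmap // fg // xq.
Qed.

Lemma chart_smooth_eq c f g p : is_chart c -> cdom c p ->
  chart_near c p (fun q => f q = g q) -> chart_smooth c f p -> chart_smooth c g p.
Proof.
move=> hc cp fg [U [Uo Up UI sf]].
have [V [Vo Vp HV]] : exists V, [/\ open V, V (cmap c p) &
    forall q, cdom c q -> V (cmap c q) -> f q = g q].
  move: fg => /nbhs_interior; rewrite /chart_near => H.
  exists (fun x => (forall q, cdom c q -> cmap c q = x -> f q = g q))°.
  split; first exact: open_interior.
    exact: nbhs_singleton H.
  by move=> q cq /interior_subset; exact.
apply: (chart_smooth_intro (U := U `&` V) (g := crep c f)) => //.
- exact: openI.
- by apply: smooth_onS sf => x [].
- by move=> q cq [Uq Vq]; rewrite crep_cmap // HV.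
Qed.

Lemma chart_smooth_cst c (k : R) p : is_chart c -> cdom c p -> chart_smooth c (fun _ => k) p.
Proof.
move=> hc cp; apply: (chart_smooth_intro (U := setT) (g := cst k)) => //.
  exact: openT.
by apply: smooth_on_cst; exact: openT.
Qed.

Lemma chart_smooth_coord c j p : is_chart c -> cdom c p -> chart_smooth c (fun q => cmap c q 0 j) p.
Proof.
move=> hc cp; apply: (chart_smooth_intro (U := setT) (g := fun x => x 0 j)) => //.
  exact: openT.
by apply: smooth_on_coord; exact: openT.
Qed.

Lemma chart_smooth_add c f g p : is_chart c -> cdom c p -> chart_smooth c f p -> chart_smooth c g p ->
  chart_smooth c (fun q => f q + g q) p.
Proof.
move=> hc cp [U [Uo Up UI sf]] [V [Vo Vp VI sg]].
have UVo := openI Uo Vo.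
apply: (chart_smooth_intro (U := U `&` V) (g := fun x => crep c f x + crep c g x)) => //.
  by apply: smooth_gen_on => //; apply: gen_add; constructor;
    [apply: smooth_onS sf | apply: smooth_onS sg] => x [].
by move=> q cq _; rewrite !crep_cmap.
Qed.

Lemma chart_smooth_mul c f g p : is_chart c -> cdom c p -> chart_smooth c f p -> chart_smooth c g p ->
  chart_smooth c (fun q => f q * g q) p.
Proof.
move=> hc cp [U [Uo Up UI sf]] [V [Vo Vp VI sg]].
have UVo := openI Uo Vo.
apply: (chart_smooth_intro (U := U `&` V) (g := fun x => crep c f x * crep c g x)) => //.
  by apply: smooth_gen_on => //; apply: gen_mul; constructor;
    [apply: smooth_onS sf | apply: smooth_onS sg] => x [].
by move=> q cq _; rewrite !crep_cmap.
Qed.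

Lemma chart_smooth_opp c f p : is_chart c -> cdom c p -> chart_smooth c f p -> chart_smooth c (fun q => - f q) p.
Proof.
move=> hc cp sf; rewrite (_ : (fun _ => _) = (fun q => -1 * f q)).
  exact: (chart_smooth_mul hc cp (chart_smooth_cst (-1) hc cp) sf).
by apply/funext => q; rewrite mulN1r.
Qed.

Lemma chart_smooth_sum (J : Type) (r : seq J) (F : J -> M -> R) c p :
  is_chart c -> cdom c p -> (forall j, chart_smooth c (F j) p) ->
  chart_smooth c (fun q => \sum_(j <- r) F j q) p.
Proof.
move=> hc cp sF; elim: r => [|j r IH].
  rewrite (_ : (fun _ => _) = (fun=> 0)); first exact: chart_smooth_cst.
  by apply/funext => x; rewrite big_nil.
rewrite (_ : (fun _ => _) = (fun x => F j x + \sum_(j <- r) F j x)).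
  exact: (chart_smooth_add hc cp (sF j) IH).
by apply/funext => x; rewrite big_cons.
Qed.

Lemma chart_smooth_cpder c f i p : is_chart c -> cdom c p -> chart_smooth c f p ->
  chart_smooth c (cpder c f i) p.
Proof.
move=> hc cp [U [Uo Up UI sf]].
exact: (chart_smooth_intro hc cp Uo Up (smooth_on_pder i sf) (fun q _ _ => erefl)).
Qed.

Lemma cpder_intro c f i p (U : set 'rV[R]_n) (g : 'rV[R]_n -> R) : is_chart c -> cdom c p ->
  open U -> U (cmap c p) ->
  (forall q, cdom c q -> U (cmap c q) -> f q = g (cmap c q)) ->
  cpder c f i p = pder g i (cmap c p).
Proof.
move=> hc cp Uo Up fg; have VO : open (U `&` cmap c @` cdom c).
  by apply: openI => //; have [] := hc.
apply: (pder_eq _ VO); last by split => //; exists p.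
by move=> x [Ux [q cq xq]]; rewrite -xq crep_cmap // fg // xq.
Qed.

Lemma cpder_eq c f g i p : is_chart c -> cdom c p ->
  chart_near c p (fun q => f q = g q) -> cpder c f i p = cpder c g i p.
Proof.
move=> hc cp fg; apply: near_eq_derive.
have [_ Io] := hc.
have cI : nbhs (cmap c p) (cmap c @` cdom c).
  by apply: open_nbhs_nbhs; split => //; exists p.
apply: filterS2 cI fg => x [q cq xq] /(_ q cq xq) E.
by rewrite -xq !crep_cmap.
Qed.

Lemma chart_smooth_is_derive c f i p : chart_smooth c f p ->
  is_derive (cmap c p) (delta_mx 0 i) (crep c f) (cpder c f i p).
Proof.
by move=> [U [Uo Up _ sf]]; apply: derivableP; exact: smooth_on_derivable sf Up.
Qed.

Lemma cpder_cst c k i p : is_chart c -> cdom c p -> cpder c (fun _ => k) i p = 0.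
Proof.
move=> hc cp; rewrite (@cpder_intro _ _ i p setT (cst k)) //; last exact: openT.
exact: derive_cst.
Qed.

Lemma cpder_coord c j i p : is_chart c -> cdom c p ->
  cpder c (fun q => cmap c q 0 j) i p = (j == i)%:R.
Proof.
move=> hc cp; rewrite (@cpder_intro _ _ i p setT (fun x => x 0 j)) //; last exact: openT.
have [_ E] := is_derive_coord (cmap c p) (delta_mx 0 i) j.
by rewrite /pder E mxE eqxx.
Qed.

Lemma cpder_add c f g i p : is_chart c -> cdom c p -> chart_smooth c f p -> chart_smooth c g p ->
  cpder c (fun q => f q + g q) i p = cpder c f i p + cpder c g i p.
Proof.
move=> hc cp sf sg.
rewrite (@cpder_intro _ _ i p setT (fun x => crep c f x + crep c g x)) //; last 2 first.
- exact: openT.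
- by move=> q cq _; rewrite !crep_cmap.
have [df _] := chart_smooth_is_derive i sf; have [dg _] := chart_smooth_is_derive i sg.
by rewrite /pder (deriveD df dg).
Qed.

Lemma cpder_mul c f g i p : is_chart c -> cdom c p -> chart_smooth c f p -> chart_smooth c g p ->
  cpder c (fun q => f q * g q) i p = f p * cpder c g i p + cpder c f i p * g p.
Proof.
move=> hc cp sf sg.
rewrite (@cpder_intro _ _ i p setT (fun x => crep c f x * crep c g x)) //; last 2 first.
- exact: openT.
- by move=> q cq _; rewrite !crep_cmap.
have [df Df] := chart_smooth_is_derive i sf; have [dg Dg] := chart_smooth_is_derive i sg.
rewrite /pder (deriveM df dg) Df Dg !crep_cmap // /GRing.scale /=.
by rewrite [X in _ + X]mulrC.
Qed.

Section Change.
Variables (c c' : chart R M n).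
Hypotheses (hc : is_chart c) (hc' : is_chart c') (cc' : compatible c c').

Let W := cmap c @` (cdom c `&` cdom c').
Let tau (x : 'rV[R]_n) : 'rV[R]_n := \row_j crep c (fun q => cmap c' q 0 j) x.

Let tau_cmap q : cdom c q -> tau (cmap c q) = cmap c' q.
Proof. by move=> cq; apply/rowP => j; rewrite mxE crep_cmap. Qed.

Let Wo : open W. Proof. by have [] := cc'. Qed.

Let stau j : smooth_on W (crep c (fun q => cmap c' q 0 j)).
Proof. by have [_] := cc'. Qed.

Let ctau x : W x -> {for x, continuous tau}.
Proof. by move=> Wx; apply: continuous_row => j; exact: smooth_on_continuous (stau j) Wx. Qed.

Lemma chart_near_change p (P : set M) : cdom c p -> cdom c' p ->
  chart_near c' p P -> chart_near c p (fun q => cdom c' q /\ P q).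
Proof.
move=> cp c'p HP.
have Wp : W (cmap c p) by exists p.
have Wn : nbhs (cmap c p) W by apply: open_nbhs_nbhs; split.
have H : \forall x \near cmap c p, forall q, cdom c' q -> cmap c' q = tau x -> P q.
  have ct : tau @ cmap c p --> tau (cmap c p) := ctau Wp.
  have HP' : nbhs (tau (cmap c p)) (fun y => forall q, cdom c' q -> cmap c' q = y -> P q).
    by rewrite tau_cmap.
  exact: (ct _ HP').
rewrite /chart_near; apply: filterS2 Wn H => x [q [cq c'q] xq] Hx q' cq' xq'.
have E : q' = q by have [inj _] := hc; apply: inj => //; rewrite xq xq'.
by rewrite E; split => //; apply: Hx => //; rewrite -xq tau_cmap.
Qed.

Lemma chart_smooth_change f p : cdom c p -> cdom c' p -> chart_smooth c' f p -> chart_smooth c f p.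
Proof.
move=> cp c'p [U [Uo Up UI sf]].
have Vo : open (W `&` tau @^-1` U).
  rewrite openE => x [Wx Ux]; apply: filterI; first by apply: open_nbhs_nbhs; split.
  have ct : tau @ x --> tau x := ctau Wx.
  by apply: (ct U); apply: open_nbhs_nbhs; split.
apply: (chart_smooth_intro (U := W `&` tau @^-1` U) (g := fun x => crep c' f (tau x))) => //.
- by split; [exists p | rewrite /= tau_cmap].
- apply: smooth_gen_on => //.
  apply: (gen_comp (V := U) (phi := fun j => crep c (fun q => cmap c' q 0 j))) => //.
    by move=> j; constructor; apply: smooth_onS (stau j) => x [].
  by move=> x [].
- move=> q cq [[q' [cq' c'q'] E] _]; rewrite tau_cmap // crep_cmap //.
  by have [inj _] := hc; rewrite -(inj _ _ cq' cq E).
Qed.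

Lemma cpder_change f i p : cdom c p -> cdom c' p -> chart_smooth c' f p ->
  cpder c f i p =
  \sum_j cpder c (fun q => cmap c' q 0 j) i p * cpder c' f j p.
Proof.
move=> cp c'p [U [Uo Up UI sf]].
have Wp : W (cmap c p) by exists p.
have dt j : is_derive (cmap c p) (delta_mx 0 i) (fun x => tau x 0 j : R)
    (cpder c (fun q => cmap c' q 0 j) i p).
  rewrite (_ : (fun x => _) = crep c (fun q => cmap c' q 0 j)).
    by apply: derivableP; exact: smooth_on_derivable (stau j) Wp.
  by apply/funext => x; rewrite mxE.
have Ut : U (tau (cmap c p)) by rewrite tau_cmap.
have := is_derive_smooth_comp Uo sf Ut dt.
rewrite tau_cmap // => -[_ <-].
apply: (@cpder_intro _ _ i p W) => // q cq [q' [cq' c'q'] E].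
have [inj _] := hc; rewrite -{1}(inj _ _ cq' cq E) -E /=.
by rewrite tau_cmap // crep_cmap.
Qed.

End Change.
End Chart.

(** * Smooth atlases and tangent vectors *)

Section Manifold.
Context {R : realType} {M : Type} {n : nat}.
Implicit Types (A : set (chart R M n)) (c : chart R M n) (f g : M -> R) (p q : M).

(** The part of the axioms of a manifold on which differential calculus rests.
    The charts of E* x R induced by those of Q and by the frames of E form such
    an atlas, although not a maximal one. *)
Record smooth_atlas A : Prop := SmoothAtlas {
  atlas_chart : forall c, A c -> is_chart c;
  atlas_cover : forall p, exists2 c, A c & cdom c p;
  atlas_compat : forall c c', A c -> A c' -> compatible c c' }.

Lemma manifold_atlas A : is_manifold A -> smooth_atlas A.
Proof. by case. Qed.

Variables (A : set (chart R M n)) (hA : smooth_atlas A).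

Definition mnear p (P : set M) := forall c, A c -> cdom c p -> chart_near c p P.

Lemma mnear_intro c p (P : set M) : A c -> cdom c p -> chart_near c p P -> mnear p P.
Proof.
move=> Ac cp HP c' Ac' c'p.
have := chart_near_change (atlas_chart hA Ac') (atlas_compat hA Ac' Ac) c'p cp HP.
by apply: chart_nearS => q _ [].
Qed.

Lemma mnear_self p (P : set M) : mnear p P -> P p.
Proof.
have [c Ac cp] := atlas_cover hA p.
by move=> HP; apply: (chart_near_self (HP c Ac cp)) cp.
Qed.

Lemma mnearT p (P : set M) : (forall q, P q) -> mnear p P.
Proof. by move=> HP c _ _; exact: chart_nearT. Qed.

Lemma mnearS p (P P' : set M) : (forall q, P q -> P' q) -> mnear p P -> mnear p P'.
Proof. by move=> PP' HP c Ac cp; apply: chart_nearS (HP c Ac cp) => q _; exact: PP'. Qed.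

Lemma mnearI p (P P' : set M) : mnear p P -> mnear p P' -> mnear p (fun q => P q /\ P' q).
Proof. by move=> HP HP' c Ac cp; apply: chart_nearI; [exact: HP | exact: HP']. Qed.

Lemma mnear_near p (P : set M) : mnear p P -> mnear p (fun q => mnear q P).
Proof.
have [c Ac cp] := atlas_cover hA p.
move=> /(_ c Ac cp) HP; apply: (mnear_intro Ac cp).
move: HP => /nbhs_interior; rewrite /chart_near; apply: filterS => x Hx q cq xq.
by apply: (mnear_intro Ac cq); rewrite /chart_near xq.
Qed.

Lemma mopenP (W : set M) : mopen A W <-> (forall p, W p -> mnear p W).
Proof.
split.
  move=> Wo p Wp c Ac cp; have [inj _] := atlas_chart hA Ac.
  have : nbhs (cmap c p) (cmap c @` (W `&` cdom c)).
    by apply: open_nbhs_nbhs; split; [exact: Wo | exists p].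
  rewrite /chart_near; apply: filterS => x [q [Wq cq] xq] q' cq' xq'.
  by rewrite -(inj _ _ cq cq') // xq'.
move=> H c Ac; have [inj Io] := atlas_chart hA Ac.
rewrite openE => _ [p [Wp cp] <-].
have Ip : nbhs (cmap c p) (cmap c @` cdom c).
  by apply: open_nbhs_nbhs; split => //; exists p.
apply: filterS2 Ip (H p Wp c Ac cp) => x [q cq xq] Hx.
by exists q => //; split => //; exact: Hx xq.
Qed.

Lemma mopenT : mopen A setT.
Proof. by apply/mopenP => p _; exact: mnearT. Qed.

Lemma mopenI (W W' : set M) : mopen A W -> mopen A W' -> mopen A (W `&` W').
Proof.
by move=> /mopenP Wo /mopenP Wo'; apply/mopenP => p [Wp Wp']; apply: mnearI; [exact: Wo|exact: Wo'].
Qed.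

Lemma mnear_cdom c p : A c -> cdom c p -> mnear p (cdom c).
Proof.
move=> Ac cp; apply: (mnear_intro Ac cp).
by apply: (@chart_nearS _ _ _ _ _ setT) => //; exact: chart_nearT.
Qed.

Lemma mopen_cdom c : A c -> mopen A (cdom c).
Proof. by move=> Ac; apply/mopenP => p; exact: mnear_cdom. Qed.

Lemma mopen_mnear (P : set M) : mopen A (fun q => mnear q P).
Proof. by apply/mopenP => p; exact: mnear_near. Qed.

Definition smooth_at f p := forall c, A c -> cdom c p -> chart_smooth c f p.

Lemma smooth_at_intro c f p : A c -> cdom c p -> chart_smooth c f p -> smooth_at f p.
Proof.
move=> Ac cp sf c' Ac' c'p.
exact: (chart_smooth_change (atlas_chart hA Ac') (atlas_chart hA Ac) (atlas_compat hA Ac' Ac)) sf.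
Qed.

Lemma smooth_at_eq f g p : mnear p (fun q => f q = g q) -> smooth_at f p -> smooth_at g p.
Proof.
by move=> fg sf c Ac cp; apply: chart_smooth_eq (fg c Ac cp) (sf c Ac cp) => //; exact: atlas_chart Ac.
Qed.

Lemma smooth_at_cst k p : smooth_at (fun _ => k) p.
Proof. by move=> c Ac cp; apply: chart_smooth_cst => //; exact: atlas_chart Ac. Qed.

Lemma smooth_at_add f g p : smooth_at f p -> smooth_at g p -> smooth_at (fun q => f q + g q) p.
Proof. by move=> sf sg c Ac cp; apply: chart_smooth_add; [exact: atlas_chart Ac| |exact: sf|exact: sg]. Qed.

Lemma smooth_at_mul f g p : smooth_at f p -> smooth_at g p -> smooth_at (fun q => f q * g q) p.
Proof. by move=> sf sg c Ac cp; apply: chart_smooth_mul; [exact: atlas_chart Ac| |exact: sf|exact: sg]. Qed.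

Lemma smooth_at_opp f p : smooth_at f p -> smooth_at (fun q => - f q) p.
Proof. by move=> sf c Ac cp; apply: chart_smooth_opp; [exact: atlas_chart Ac| |exact: sf]. Qed.

Lemma smooth_at_sum (J : Type) (r : seq J) (F : J -> M -> R) p :
  (forall j, smooth_at (F j) p) -> smooth_at (fun q => \sum_(j <- r) F j q) p.
Proof.
move=> sF c Ac cp; apply: chart_smooth_sum; [exact: atlas_chart Ac| |move=> j; exact: sF]; done.
Qed.

Lemma smooth_at_coord c j p : A c -> cdom c p -> smooth_at (fun q => cmap c q 0 j) p.
Proof.
move=> Ac cp; apply: (smooth_at_intro Ac cp); apply: chart_smooth_coord => //; exact: atlas_chart Ac.
Qed.

Lemma smooth_at_cpder c f i p : A c -> cdom c p -> smooth_at f p -> smooth_at (cpder c f i) p.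
Proof.
move=> Ac cp sf; apply: (smooth_at_intro Ac cp); apply: chart_smooth_cpder => //; last exact: sf.
exact: atlas_chart Ac.
Qed.

Lemma smooth_funP (W : set M) f : mopen A W ->
  smooth_fun A W f <-> forall p, W p -> smooth_at f p.
Proof.
move=> Wo; split.
  move=> sf p Wp c Ac cp; exists (cmap c @` (W `&` cdom c)); split.
  - exact: Wo.
  - by exists p.
  - by move=> _ [q [_ cq] <-]; exists q.
  - exact: sf.
move=> sf c Ac s _ [p [Wp cp] <-].
have [U [Uo Up _ sU]] := sf p Wp c Ac cp.
exact: sU.
Qed.

Lemma tspace_eq c p (v w : tspace A p) : A c -> cdom c p -> v c = w c -> v = w.
Proof.
move=> Ac cp vw; apply/val_inj/funext => c' /=.
have /asboolP [v0 vJ] := tvalP v; have /asboolP [w0 wJ] := tvalP w.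
case: (pselect (A c' /\ cdom c' p)) => [[Ac' c'p]|nc']; last by rewrite v0 // w0.
by rewrite (vJ c c') // (wJ c c') // vw.
Qed.

Definition jac c c' p : 'M[R]_n := \matrix_(i, j) cpder c (fun q => cmap c' q 0 j) i p.

Lemma tval_change p (v : tspace A p) c c' : A c -> A c' -> cdom c p -> cdom c' p ->
  v c' = v c *m jac c c' p.
Proof. by have /asboolP [_ vJ] := tvalP v; exact: vJ. Qed.

Lemma jac_comp c c' c'' p : A c -> A c' -> A c'' -> cdom c p -> cdom c' p -> cdom c'' p ->
  jac c c'' p = jac c c' p *m jac c' c'' p.
Proof.
move=> Ac Ac' Ac'' cp c'p c''p; apply/matrixP => i j; rewrite !mxE.
rewrite (cpder_change (atlas_chart hA Ac) (atlas_chart hA Ac') (atlas_compat hA Ac Ac') i cp c'p).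
  by apply: eq_bigr => k _; rewrite !mxE.
by apply: smooth_at_coord.
Qed.

(** The Jacobian matrices force the components in the other charts; they are
    consistent by the chain rule. *)
Lemma tvec_exists c p (x : 'rV[R]_n) : A c -> cdom c p ->
  exists v : tspace A p, v c = x.
Proof.
move=> Ac cp.
pose v c' := if pselect (A c' /\ cdom c' p) then x *m jac c c' p else 0.
have vP : v \in tvec_pred A p.
  apply/asboolP; split=> [c' nc'|c' c'' Ac' Ac'' c'p c''p]; rewrite /v.
    by case: pselect.
  case: pselect => [?|]; last by case.
  case: pselect => [?|]; last by case.
  by rewrite -mulmxA -jac_comp.
exists (TVec vP); rewrite /= /v; case: pselect => [?|]; last by case.
rewrite (_ : jac c c p = 1%:M) ?mulmx1 //; apply/matrixP => i j; rewrite !mxE.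
rewrite cpder_coord //; last exact: atlas_chart Ac.
by rewrite eq_sym.
Qed.

(** [tapp] is computed in an unspecified chart around p. The Jacobian matrix
    which relates the components of v in both charts is the one of the chain
    rule for f. *)
Lemma tappE c p (v : tspace A p) f : A c -> cdom c p -> smooth_at f p ->
  tapp v f = \sum_i v c 0 i * cpder c f i p.
Proof.
move=> Ac cp sf; rewrite /tapp.
have [[c' [Ac' c'p] ->]|[H _]] := pickoptP [set c | A c /\ cdom c p]; last by case: (H c).
rewrite /= (tval_change v Ac Ac') //.
transitivity (\sum_i \sum_j v c 0 j * jac c c' p j i * cpder c' f i p).
  by apply: eq_bigr => i _; rewrite mxE mulr_suml.
rewrite exchange_big /=; apply: eq_bigr => j _.
rewrite (cpder_change (atlas_chart hA Ac) (atlas_chart hA Ac') (atlas_compat hA Ac Ac')) //; last exact: sf.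
by rewrite mulr_sumr; apply: eq_bigr => i _; rewrite mxE mulrA.
Qed.

Lemma tapp_eq p (v : tspace A p) f g : mnear p (fun q => f q = g q) ->
  tapp v f = tapp v g.
Proof.
move=> fg; rewrite /tapp.
have [[c [Ac cp] ->]|[H ->]] // := pickoptP [set c | A c /\ cdom c p].
rewrite /=; apply: eq_bigr => i _; congr (_ * _).
by apply: cpder_eq (fg c Ac cp) => //; exact: atlas_chart Ac.
Qed.

Lemma tapp_cst p (v : tspace A p) k : tapp v (fun _ => k) = 0.
Proof.
have [c Ac cp] := atlas_cover hA p.
rewrite (tappE v Ac cp); last exact: smooth_at_cst.
by apply: big1 => i _; rewrite cpder_cst ?mulr0 //; exact: atlas_chart Ac.
Qed.

Lemma tapp_coord c p (v : tspace A p) j : A c -> cdom c p ->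
  tapp v (fun q => cmap c q 0 j) = v c 0 j.
Proof.
move=> Ac cp; rewrite (tappE v Ac cp); last exact: smooth_at_coord.
rewrite (bigD1 j) //= cpder_coord ?eqxx ?mulr1 //; last exact: atlas_chart Ac.
rewrite big1 ?addr0 // => i ij; rewrite cpder_coord //; last exact: atlas_chart Ac.
by rewrite eq_sym (negbTE ij) mulr0.
Qed.

Lemma tapp_add p (v : tspace A p) f g : smooth_at f p -> smooth_at g p ->
  tapp v (fun q => f q + g q) = tapp v f + tapp v g.
Proof.
move=> sf sg; have [c Ac cp] := atlas_cover hA p.
rewrite (tappE v Ac cp sf) (tappE v Ac cp sg) (tappE v Ac cp (smooth_at_add sf sg)).
rewrite -big_split; apply: eq_bigr => i _ /=.
by rewrite cpder_add ?mulrDr //; [exact: atlas_chart Ac | exact: sf | exact: sg].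
Qed.

Lemma tapp_mul p (v : tspace A p) f g : smooth_at f p -> smooth_at g p ->
  tapp v (fun q => f q * g q) = f p * tapp v g + g p * tapp v f.
Proof.
move=> sf sg; have [c Ac cp] := atlas_cover hA p.
rewrite (tappE v Ac cp sf) (tappE v Ac cp sg) (tappE v Ac cp (smooth_at_mul sf sg)).
rewrite !mulr_sumr -big_split; apply: eq_bigr => i _ /=.
rewrite cpder_mul //; [|exact: atlas_chart Ac | exact: sf | exact: sg].
by ring.
Qed.

Lemma tapp0 p f : tapp (0 : tspace A p) f = 0.
Proof.
have := tapp_linear (-1) (0 : tspace A p) 0 f.
by rewrite scaler0 addr0 mulN1r addNr.
Qed.

Lemma tappZ p a (v : tspace A p) f : tapp (a *: v) f = a * tapp v f.
Proof. by rewrite -[_ *: v]addr0 tapp_linear tapp0 addr0. Qed.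

Lemma tappD p (v w : tspace A p) f : tapp (v + w) f = tapp v f + tapp w f.
Proof. by rewrite -{1}[v]scale1r tapp_linear mul1r. Qed.

End Manifold.

(** * Bump functions on a manifold *)

Section ManifoldBump.
Context {R : realType} {M : Type} {n : nat}.
Variables (A : set (chart R M n)) (hM : is_manifold A).
Let hA := manifold_atlas hM.

(** A compact subset of the image of a chart comes from a closed subset of M.
    Otherwise, the traces on it of the neighbourhoods of q generate a filter,
    which has a cluster point; that point and q have no disjoint
    neighbourhoods, in contradiction with the Hausdorff property. *)
Lemma manifold_support_closed c (K : set 'rV[R]_n) q : A c -> compact K ->
  K `<=` cmap c @` cdom c -> ~ (cdom c q /\ K (cmap c q)) ->
  mnear A q (fun q' => ~ (cdom c q' /\ K (cmap c q'))).
Proof.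
move=> Ac cK KI Sq; have [inj Io] := atlas_chart hA Ac.
pose S := [set q' | cdom c q' /\ K (cmap c q')].
case: (pselect (cdom c q)) => [cq|ncq].
  have Kq : (~` K) (cmap c q) by move=> Kq; apply: Sq.
  have Ko : open (~` K).
    by rewrite openC; apply: compact_closed => //; exact: norm_hausdorff.
  apply: (mnear_intro hA Ac cq); rewrite /chart_near.
  apply: filterS (open_nbhs_nbhs (conj Ko Kq)) => x Kx q' cq' xq' [_].
  by rewrite xq'.
apply: contrapT => Hn.
(* The traces on the compact set of the neighbourhoods of q, read in c. *)
pose F : set_system 'rV[R]_n := fun X => exists V, [/\ mopen A V, V q &
  forall q', V q' -> S q' -> X (cmap c q')].
have FF : ProperFilter F.
  apply: Build_ProperFilter_ex.
    move=> X [V [Vo Vq VX]].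
    case: (pselect (exists2 q', V q' & S q')) => [[q' Vq' Sq']|nVS].
      by exists (cmap c q'); exact: VX.
    exfalso; apply: Hn; apply: mnearS ((mopenP hA V).1 Vo q Vq) => q' Vq' Sq'.
    by apply: nVS; exists q'.
  split.
  - by exists setT; split => //; exact: mopenT.
  - move=> X Y [V [Vo Vq VX]] [V' [Vo' Vq' VX']]; exists (V `&` V').
    split => //; first exact: mopenI.
    by move=> q' [Vq1 Vq2] Sq'; split; [exact: VX | exact: VX'].
  - move=> X Y XY [V [Vo Vq VX]]; exists V; split => // q' Vq' Sq'.
    by apply: XY; exact: VX.
have FK : F K.
  by exists setT; split => //; [exact: mopenT | move=> q' _ []].
have [x [Kx clx]] := cK F FF FK.
have [k ck kx] := KI x Kx.
have kq : k <> q by move=> kq; apply: ncq; rewrite -kq.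
have [U [V [Uo Vo Uk Vq UV]]] := mfd_hausdorff hM kq.
have FX : F (cmap c @` (V `&` S)).
  by exists V; split => // q' Vq' Sq'; exists q'.
have NU : nbhs x (cmap c @` (U `&` cdom c)).
  apply: open_nbhs_nbhs; split; first exact: Uo.
  by exists k.
have [_ [[q1 [Vq1 [cq1 _]] <-] [q2 [Uq2 cq2] E]]] := clx _ _ FX NU.
have : (U `&` V) q1 by split => //; rewrite -(inj _ _ cq2 cq1 E).
by rewrite UV.
Qed.

Lemma manifold_bump p (W : set M) : mopen A W -> W p ->
  exists f : M -> R, [/\ smooth_fun A setT f, mnear A p (fun q => f q = 1) &
    forall q, ~ W q -> mnear A q (fun q' => f q' = 0)].
Proof.
move=> Wo Wp; have [c Ac cp] := atlas_cover hA p.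
have hc := atlas_chart hA Ac; have [inj Io] := hc.
pose V := cmap c @` (W `&` cdom c).
have Vp : V (cmap c p) by exists p.
have [b [K [sb cK KV b0 b1]]] := bump_rV (Wo c Ac) Vp.
have KI : K `<=` cmap c @` cdom c by move=> x /KV [q [_ cq] <-]; exists q.
pose f q := if pselect (cdom c q) then b (cmap c q) else 0.
have fE q : cdom c q -> f q = b (cmap c q) by rewrite /f; case: pselect.
have f0 q : ~ (cdom c q /\ K (cmap c q)) -> f q = 0.
  rewrite /f; case: pselect => // cq nK; apply: b0 => Kq; exact: nK.
have fn q : ~ (cdom c q /\ K (cmap c q)) -> mnear A q (fun q' => f q' = 0).
  by move=> /(manifold_support_closed Ac cK KI); apply: mnearS => q'; exact: f0.
exists f; split.
- apply/smooth_funP => //; first exact: mopenT.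
  move=> q _; case: (pselect (cdom c q)) => [cq|ncq].
    apply: (smooth_at_intro hA Ac cq).
    apply: (chart_smooth_intro (U := setT) (g := b)) => //; first exact: openT.
    by move=> q' cq' _; exact: fE.
  apply: (smooth_at_eq hA (f := fun=> 0)); last exact: smooth_at_cst.
  by apply: mnearS (fn q _) => [q' ->|] //; case.
- apply: (mnear_intro hA Ac cp); rewrite /chart_near.
  by apply: filterS b1 => x bx q cq xq; rewrite fE // xq.
- move=> q nWq; apply: fn => -[cq /KV [q' [Wq' cq'] E]].
  by apply: nWq; rewrite -(inj _ _ cq' cq E).
Qed.

End ManifoldBump.

(** * Smooth frames of a vector bundle *)

Section Bundle.
Context {R : realType} {M : Type} {n : nat} {I : finType} {V : M -> lmodType R}.
Implicit Types (B : set (frame I V)) (e : frame I V) (s t : section V) (W : set M).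
Implicit Types (f : M -> R) (p q : M).

(** What the local frames of E and those of its prolongation have in common.
    The latter do not form a maximal family. *)
Record smooth_frames (A : set (chart R M n)) B : Prop := SmoothFrames {
  fr_frame : forall e, B e -> is_frame A e;
  fr_cover : forall p, exists2 e, B e & fdom e p;
  fr_compat : forall e, B e -> forall a, smooth_section A B (fdom e) (fvec e a) }.

Lemma vector_bundle_frames A B : is_vector_bundle A B -> smooth_frames A B.
Proof. by case. Qed.

Definition fcoord e p (u : V p) : {ffun I -> R} :=
  odflt [ffun=> 0] (pickopt [set x : {ffun I -> R} | u = \sum_a x a *: fvec e a p]).

Section Coordinates.
Variables (A : set (chart R M n)) (e : frame I V).
Hypothesis (he : is_frame A e).

Lemma fcoordE p (u : V p) : fdom e p -> u = \sum_a fcoord e u a *: fvec e a p.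
Proof.
move=> ep; have [x [xu _]] := he.2 p ep u; rewrite /fcoord.
have [[y yu ->]|[H _]] := pickoptP [set x : {ffun I -> R} | u = \sum_a x a *: fvec e a p].
  exact: yu.
by case: (H x).
Qed.

Lemma fcoord_unique p (u : V p) (g : I -> R) : fdom e p ->
  u = \sum_a g a *: fvec e a p -> forall a, fcoord e u a = g a.
Proof.
move=> ep ug a; have [x [_ xu]] := he.2 p ep u.
rewrite -(xu _ (fcoordE u ep)) (xu (finfun g)) ?ffunE //.
by rewrite ug; apply: eq_bigr => b _; rewrite ffunE.
Qed.

Lemma fcoordD p (u v : V p) a : fdom e p ->
  fcoord e (u + v) a = fcoord e u a + fcoord e v a.
Proof.
move=> ep; apply: (@fcoord_unique _ _ (fun a => fcoord e u a + fcoord e v a)) => //.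
rewrite {1}(fcoordE u ep) {1}(fcoordE v ep) -big_split /=.
by apply: eq_bigr => b _; rewrite scalerDl.
Qed.

Lemma fcoordZ p k (u : V p) a : fdom e p -> fcoord e (k *: u) a = k * fcoord e u a.
Proof.
move=> ep; apply: (@fcoord_unique _ _ (fun a => k * fcoord e u a)) => //.
rewrite {1}(fcoordE u ep) scaler_sumr.
by apply: eq_bigr => b _; rewrite scalerA.
Qed.

Lemma fcoord0 p a : fdom e p -> fcoord e (0 : V p) a = 0.
Proof. by move=> ep; rewrite -[X in fcoord e X](scale0r (0 : V p)) fcoordZ // mul0r. Qed.

Lemma fcoord_sum p (J : Type) (r : seq J) (F : J -> V p) a : fdom e p ->
  fcoord e (\sum_(j <- r) F j) a = \sum_(j <- r) fcoord e (F j) a.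
Proof.
move=> ep; elim: r => [|j r IH]; first by rewrite !big_nil fcoord0.
by rewrite !big_cons fcoordD // IH.
Qed.

Lemma fcoord_fvec p a b : fdom e p -> fcoord e (fvec e a p) b = (a == b)%:R.
Proof.
move=> ep; apply: (@fcoord_unique _ _ (fun b => (a == b)%:R)) => //.
rewrite (bigD1 a) //= eqxx scale1r big1 ?addr0 // => c ca.
by rewrite eq_sym (negbTE ca) scale0r.
Qed.

End Coordinates.

Variables (A : set (chart R M n)) (hA : smooth_atlas A).
Variables (B : set (frame I V)) (hB : smooth_frames A B).

Definition section_smooth_at s p := forall e, B e -> fdom e p -> forall a,
  smooth_at A (fun q => fcoord e (s q) a) p.

Lemma mnear_fdom e p : B e -> fdom e p -> mnear A p (fdom e).
Proof. by move=> Be ep; have [eo _] := fr_frame hB Be; apply: (mopenP hA _).1. Qed.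

Lemma smooth_sectionP W s : mopen A W ->
  smooth_section A B W s <-> forall p, W p -> section_smooth_at s p.
Proof.
move=> Wo; split.
  move=> ss p Wp e Be ep a; have [g [sg sE]] := ss e Be.
  have he := fr_frame hB Be; have [eo _] := he.
  have WeO := mopenI hA Wo eo.
  apply: (smooth_at_eq hA (f := g a)); last exact: ((smooth_funP _ WeO).1 (sg a) p (conj Wp ep)).
  apply: mnearS ((mopenP hA _).1 WeO p (conj Wp ep)) => q [Wq eq].
  by rewrite (fcoord_unique he (g := g^~ q) eq (sE q Wq eq)).
move=> ss e Be; exists (fun a q => fcoord e (s q) a); have he := fr_frame hB Be.
split=> [a|p Wp ep]; last exact: (fcoordE he (s p) ep).
have [eo _] := he; apply/(smooth_funP _ (mopenI hA Wo eo)) => p [Wp ep].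
exact: ss.
Qed.

Lemma section_smooth_at_fvec e a p : B e -> fdom e p -> section_smooth_at (fvec e a) p.
Proof.
move=> Be ep; have [eo _] := fr_frame hB Be.
exact: (smooth_sectionP _ eo).1 (fr_compat hB Be a) p ep.
Qed.

Lemma section_smooth_at_intro e s p : B e -> fdom e p ->
  (forall a, smooth_at A (fun q => fcoord e (s q) a) p) -> section_smooth_at s p.
Proof.
move=> Be ep ss e' Be' e'p b; have he := fr_frame hB Be; have he' := fr_frame hB Be'.
apply: (smooth_at_eq hA (f := fun q => \sum_a fcoord e (s q) a * fcoord e' (fvec e a q) b)).
  apply: mnearS (mnearI (mnear_fdom Be ep) (mnear_fdom Be' e'p)) => q [eq e'q].
  rewrite [in RHS](fcoordE he (s q) eq) (fcoord_sum he') //.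
  by apply: eq_bigr => a _; rewrite (fcoordZ he').
by apply: (smooth_at_sum hA) => a; apply: (smooth_at_mul hA); [exact: ss | exact: section_smooth_at_fvec].
Qed.

Lemma section_smooth_at_eq s t p : mnear A p (fun q => s q = t q) -> section_smooth_at s p -> section_smooth_at t p.
Proof.
move=> st ss e Be ep a; apply: (smooth_at_eq hA) (ss e Be ep a).
by apply: mnearS st => q ->.
Qed.

Lemma section_smooth_at_add s t p : section_smooth_at s p -> section_smooth_at t p -> section_smooth_at (fun q => s q + t q) p.
Proof.
move=> ss st e Be ep a; have he := fr_frame hB Be.
apply: (smooth_at_eq hA (f := fun q => fcoord e (s q) a + fcoord e (t q) a)).
  by apply: mnearS (mnear_fdom Be ep) => q eq; rewrite (fcoordD he).
by apply: (smooth_at_add hA); [exact: ss | exact: st].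
Qed.

Lemma section_smooth_at_scale f s p : smooth_at A f p -> section_smooth_at s p -> section_smooth_at (fun q => f q *: s q) p.
Proof.
move=> sf ss e Be ep a; have he := fr_frame hB Be.
apply: (smooth_at_eq hA (f := fun q => f q * fcoord e (s q) a)).
  by apply: mnearS (mnear_fdom Be ep) => q eq; rewrite (fcoordZ he).
by apply: (smooth_at_mul hA) => //; exact: ss.
Qed.

Lemma section_smooth_at0 p : section_smooth_at (fun q => 0) p.
Proof.
move=> e Be ep a; have he := fr_frame hB Be.
apply: (smooth_at_eq hA (f := fun=> 0)); last exact: smooth_at_cst.
by apply: mnearS (mnear_fdom Be ep) => q eq; rewrite (fcoord0 he).
Qed.

Lemma section_smooth_at_sum (J : Type) (r : seq J) (F : J -> section V) p :
  (forall j, section_smooth_at (F j) p) -> section_smooth_at (fun q => \sum_(j <- r) F j q) p.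
Proof.
move=> sF; elim: r => [|j r IH].
  apply: (@section_smooth_at_eq (fun q => 0)); last exact: section_smooth_at0.
  by apply: mnearT => q; rewrite big_nil.
apply: (@section_smooth_at_eq (fun q => F j q + \sum_(j <- r) F j q)); last exact: (section_smooth_at_add (sF j) IH).
by apply: mnearT => q; rewrite big_cons.
Qed.

Lemma global_sectionP s : smooth_section A B setT s <-> forall p, section_smooth_at s p.
Proof.
have TO := mopenT hA.
by split=> [/(smooth_sectionP _ TO) H p|H]; [exact: H | apply/(smooth_sectionP _ TO) => p _].
Qed.

Lemma global_funP f : smooth_fun A setT f <-> forall p, smooth_at A f p.
Proof.
have TO := mopenT hA.
by split=> [/(smooth_funP _ TO) H p|H]; [exact: H | apply/(smooth_funP _ TO) => p _].
Qed.

(** Vanishing near the points outside of W, and not merely at these points, is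
    what makes the extension by 0 of a smooth object on W smooth. *)
Definition cutoff f W := (forall p, smooth_at A f p) /\
  forall q, ~ W q -> mnear A q (fun q' => f q' = 0).

Lemma cutoff_out f W q : cutoff f W -> ~ W q -> f q = 0.
Proof. by move=> [_ H] /H /(mnear_self hA). Qed.

Lemma cutoff_mul f W g : cutoff f W -> (forall p, W p -> smooth_at A g p) ->
  forall p, smooth_at A (fun q => f q * g q) p.
Proof.
move=> [sf f0] sg p; case: (pselect (W p)) => [Wp|nWp].
  by apply: (smooth_at_mul hA); [exact: sf | exact: sg].
apply: (smooth_at_eq hA (f := fun=> 0)); last exact: smooth_at_cst.
by apply: mnearS (f0 _ nWp) => q ->; rewrite mul0r.
Qed.

Lemma cutoff_section f W s : cutoff f W -> (forall p, W p -> section_smooth_at s p) ->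
  smooth_section A B setT (fun q => f q *: s q).
Proof.
move=> [sf f0] ss; apply/global_sectionP => p; case: (pselect (W p)) => [Wp|nWp].
  by apply: section_smooth_at_scale; [exact: sf | exact: ss].
apply: (@section_smooth_at_eq (fun q => 0)); last exact: section_smooth_at0.
by apply: mnearS (f0 _ nWp) => q ->; rewrite scale0r.
Qed.

(** * Tensoriality of the exterior derivative *)

Variables (rho : forall p, {linear V p -> tspace A p}).
Variables (br : section V -> section V -> section V).
Hypothesis hL : is_lie_algebroid B rho br.

Local Notation smooth := (smooth_section A B setT).

(** By the Leibniz rule, the bracket of s with the common section
    f t = f t' equals [br s t] at p up to a term that only involves
    t p = t' p. *)
Lemma bracket_local_r s t t' p f : smooth s -> smooth t -> smooth t' ->
  (forall q, smooth_at A f q) -> f p = 1 -> (forall q, f q *: t q = f q *: t' q) ->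
  br s t p = br s t' p.
Proof.
move=> ss st st' sf fp tt'.
have sf' : smooth_fun A setT f by apply/global_funP.
have := la_leibniz hL ss st sf' p; have := la_leibniz hL ss st' sf' p.
have -> : (fun q => f q *: t q) = (fun q => f q *: t' q).
  exact: functional_extensionality_dep.
move=> ->; rewrite fp !scale1r.
have -> : t p = t' p by have := tt' p; rewrite fp !scale1r.
by move=> /addIr.
Qed.

Section ExteriorDerivative.
Variable mu : forall p, V p -> R.
Hypothesis mu_linear : forall p k (u v : V p), mu (k *: u + v) = k * mu u + mu v.
Hypothesis mu_smooth : forall s, smooth s -> forall p, smooth_at A (fun q => mu (s q)) p.

Local Notation D := (ext_d1 rho br mu).

Lemma form0 p : mu (0 : V p) = 0.
Proof.
have := mu_linear (-1) (0 : V p) 0.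
by rewrite scaler0 addr0 mulN1r addNr.
Qed.

Lemma formD p (u v : V p) : mu (u + v) = mu u + mu v.
Proof. by rewrite -{1}[u]scale1r mu_linear mul1r. Qed.

Lemma formZ p k (u : V p) : mu (k *: u) = k * mu u.
Proof. by rewrite -[_ *: u]addr0 mu_linear form0 addr0. Qed.

Lemma formN p (u : V p) : mu (- u) = - mu u.
Proof. by rewrite -scaleN1r formZ mulN1r. Qed.

Lemma ext_d1_skew s t p : smooth s -> smooth t -> D s t p = - D t s p.
Proof.
move=> ss st; rewrite /ext_d1 (la_skew hL ss st) formN !opprB opprK.
by ring.
Qed.

(** The term rho(s)(f) mu(t) coming from the derivative of mu(f t) cancels the
    one coming from the Leibniz rule for the bracket. *)
Lemma ext_d1_scale s t f p : smooth s -> smooth t -> (forall p, smooth_at A f p) ->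
  D s (fun q => f q *: t q) p = f p * D s t p.
Proof.
move=> ss st sf; have sf' : smooth_fun A setT f by apply/global_funP.
rewrite /ext_d1 (la_leibniz hL ss st sf') /anchor_der.
rewrite (_ : (fun q => mu (f q *: t q)) = (fun q => f q * mu (t q))); last first.
  by apply/funext => q; rewrite formZ.
rewrite (tapp_mul hA); [|exact: sf|exact: mu_smooth].
rewrite linearZ tappZ formD !formZ.
by ring.
Qed.

Lemma smooth_section_add s t : smooth s -> smooth t -> smooth (fun q => s q + t q).
Proof.
move=> /global_sectionP ss /global_sectionP st; apply/global_sectionP => p.
exact: section_smooth_at_add.
Qed.

Lemma smooth_section_scale f s : (forall p, smooth_at A f p) -> smooth s -> smooth (fun q => f q *: s q).
Proof.
move=> sf /global_sectionP ss; apply/global_sectionP => p; exact: section_smooth_at_scale.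
Qed.

Lemma smooth_section_sum (J : Type) (r : seq J) (F : J -> section V) :
  (forall j, smooth (F j)) -> smooth (fun q => \sum_(j <- r) F j q).
Proof.
move=> sF; apply/global_sectionP => p; apply: section_smooth_at_sum => j.
exact: (global_sectionP _).1.
Qed.

Lemma ext_d1_add s t t' p : smooth s -> smooth t -> smooth t' ->
  D s (fun q => t q + t' q) p = D s t p + D s t' p.
Proof.
move=> ss st st'; have stt := smooth_section_add st st'.
have E : br s (fun q => t q + t' q) p = br s t p + br s t' p.
  rewrite (la_skew hL ss stt) (la_skew hL ss st) (la_skew hL ss st').
  have := la_linear hL 1 st st' ss p.
  rewrite (_ : (fun q => 1 *: t q + t' q) = (fun q => t q + t' q)); last first.
    by apply: functional_extensionality_dep => q; rewrite scale1r.
  by move=> ->; rewrite scale1r opprD.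
rewrite /ext_d1 E /anchor_der.
rewrite (_ : (fun q => mu (t q + t' q)) = (fun q => mu (t q) + mu (t' q))); last first.
  by apply/funext => q; rewrite formD.
rewrite (tapp_add hA); [|exact: mu_smooth|exact: mu_smooth].
rewrite linearD tappD formD.
by ring.
Qed.

Lemma ext_d1_0 s p : smooth s -> D s (fun q => 0) p = 0.
Proof.
move=> ss.
have s0 : smooth (fun q => 0) by apply/global_sectionP => q; exact: section_smooth_at0.
have := ext_d1_scale p ss s0 (smooth_at_cst hA 0).
rewrite (_ : (fun q => 0 *: 0) = (fun q => 0 : V q)) ?mul0r //.
by apply: functional_extensionality_dep => q; rewrite scale0r.
Qed.

Lemma ext_d1_sum (J : Type) (r : seq J) s (F : J -> section V) p :
  smooth s -> (forall j, smooth (F j)) ->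
  D s (fun q => \sum_(j <- r) F j q) p = \sum_(j <- r) D s (F j) p.
Proof.
move=> ss sF; elim: r => [|j r IH].
  rewrite (_ : (fun q => _) = (fun q => 0)); last first.
    by apply: functional_extensionality_dep => q; rewrite big_nil.
  by rewrite big_nil ext_d1_0.
rewrite (_ : (fun q => _) = (fun q => F j q + \sum_(j <- r) F j q)); last first.
  by apply: functional_extensionality_dep => q; rewrite big_cons.
by rewrite big_cons -IH (ext_d1_add p ss (sF j) (smooth_section_sum r sF)).
Qed.

(** The section f^2 t, which may replace t as f p = 1, is a combination of the
    global sections f e_a with the global coefficients f t^a. In particular the
    left-hand side depends on t only through its value at p. *)
Lemma ext_d1_frame e f s t p : B e -> cutoff f (fdom e) -> f p = 1 -> fdom e p ->
  smooth s -> smooth t ->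
  D s t p = \sum_a fcoord e (t p) a * D s (fun q => f q *: fvec e a q) p.
Proof.
move=> Be cf fp ep ss st; have [sf _] := cf; have he := fr_frame hB Be.
have st' := (global_sectionP t).1 st.
have sft a q : smooth_at A (fun q => f q * fcoord e (t q) a) q.
  by move: q; apply: cutoff_mul cf _ => q eq; exact: st'.
have sfe a : smooth (fun q => f q *: fvec e a q).
  by apply: cutoff_section cf _ => q eq; exact: section_smooth_at_fvec.
(* One factor f extends the coefficients by 0, the other one the frame. *)
have E : (fun q => (f q * f q) *: t q) =
    (fun q => \sum_a (f q * fcoord e (t q) a) *: (f q *: fvec e a q)).
  apply: functional_extensionality_dep => q; case: (pselect (fdom e q)) => [eq|neq].
    rewrite {1}(fcoordE he (t q) eq) scaler_sumr; apply: eq_bigr => a _.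
    by rewrite !scalerA; congr (_ *: _); ring.
  by rewrite (cutoff_out cf neq) mul0r scale0r big1 // => a _; rewrite mul0r scale0r.
have sff q : smooth_at A (fun q => f q * f q) q by apply: (smooth_at_mul hA).
have := ext_d1_scale p ss st sff; rewrite fp !mul1r => <-.
have sffe a : smooth (fun q => (f q * fcoord e (t q) a) *: (f q *: fvec e a q)).
  exact: (smooth_section_scale (sft a) (sfe a)).
rewrite E (ext_d1_sum _ p ss sffe).
apply: eq_bigr => a _.
by rewrite (ext_d1_scale p ss (sfe a) (sft a)) fp mul1r.
Qed.

End ExteriorDerivative.
End Bundle.

(** * Structure functions of a Lie algebroid *)

Section StructureFunctions.
Context {R : realType} {M : Type} {n : nat} {I : finType} {V : M -> lmodType R}.
Variables (A : set (chart R M n)) (hM : is_manifold A).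
Variables (B : set (frame I V)) (hB : smooth_frames A B).
Variables (rho : forall p, {linear V p -> tspace A p}).
Variables (br : section V -> section V -> section V).
Hypothesis hL : is_lie_algebroid B rho br.
Let hA := manifold_atlas hM.
Local Notation smooth := (smooth_section A B setT).
Implicit Types (e : frame I V) (s t : section V) (p q : M).

Lemma cutoff_exists p (W : set M) : mopen A W -> W p ->
  exists2 f, cutoff A f W & mnear A p (fun q => f q = 1).
Proof.
move=> Wo Wp; have [f [sf f1 f0]] := manifold_bump hM Wo Wp.
by exists f => //; split => //; exact/(global_funP hA).
Qed.

Lemma bracket_near_r s t t' p : smooth s -> smooth t -> smooth t' ->
  mnear A p (fun q => t q = t' q) -> br s t p = br s t' p.
Proof.
move=> ss st st' tt'.
have [f cf f1] := @cutoff_exists p [set q | mnear A q (fun q => t q = t' q)]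
  (mopen_mnear hA (P := _)) tt'.
apply: (bracket_local_r hA hL (f := f)) => //; first by case: cf.
  exact: (mnear_self hA f1).
move=> q; case: (pselect (mnear A q (fun q => t q = t' q))) => [H|H].
  by rewrite (mnear_self hA H).
by rewrite (cutoff_out hA cf H) !scale0r.
Qed.

Lemma bracket_near s s' t t' p : smooth s -> smooth s' -> smooth t -> smooth t' ->
  mnear A p (fun q => s q = s' q) -> mnear A p (fun q => t q = t' q) ->
  br s t p = br s' t' p.
Proof.
move=> ss ss' st st' Es Et.
rewrite (bracket_near_r ss st st' Et) (la_skew hL ss st').
by rewrite (bracket_near_r st' ss ss' Es) -(la_skew hL ss' st').
Qed.

(** The frame is extended around each point p by means of a function equal to 1
    near p. As the bracket is local, the extension does not affect the result;
    near p all the values are thus components of the bracket of the two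
    sections chosen at p, which is smooth. *)
Lemma structure_functions_exist e : B e -> exists C : I -> I -> I -> M -> R,
  structure_functions A B br e C /\
  forall k a b p, fdom e p -> smooth_at A (C k a b) p.
Proof.
move=> Be; have he := fr_frame hB Be; have [eo _] := he.
have /choice [f Hf] : forall p, exists f : M -> R, fdom e p ->
    cutoff A f (fdom e) /\ mnear A p (fun q => f q = 1).
  move=> p; case: (pselect (fdom e p)) => [ep|nep]; last by exists (fun=> 0).
  by have [f cf f1] := cutoff_exists eo ep; exists f.
pose S p a : section V := fun q => f p q *: fvec e a q.
have sS p a : fdom e p -> smooth (S p a).
  move=> ep; have [cf _] := Hf p ep.
  by apply: (cutoff_section hA hB cf) => q eq; exact: section_smooth_at_fvec.
have S1 p a : fdom e p -> mnear A p (fun q => S p a q = fvec e a q).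
  move=> ep; have [_ f1] := Hf p ep.
  by apply: mnearS f1 => q fq; rewrite /S fq scale1r.
have key p s t a b : fdom e p -> smooth s -> smooth t ->
    mnear A p (fun q => s q = fvec e a q) -> mnear A p (fun q => t q = fvec e b q) ->
    br s t p = br (S p a) (S p b) p.
  move=> ep ss st Es Et; apply: bracket_near => //; try exact: sS.
    by apply: mnearS (mnearI Es (S1 p a ep)) => q [-> ->].
  by apply: mnearS (mnearI Et (S1 p b ep)) => q [-> ->].
exists (fun k a b p => fcoord e (br (S p a) (S p b) p) k); split.
  move=> a b U s t Uo Ue ss st Es Et p Up; have ep := Ue p Up.
  have Un := (mopenP hA _).1 Uo p Up.
  rewrite (key p s t a b) //.
  - exact: (fcoordE he _ ep).
  - by apply: mnearS Un => q; exact: Es.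
  - by apply: mnearS Un => q; exact: Et.
move=> k a b p ep.
apply: (smooth_at_eq hA (f := fun q => fcoord e (br (S p a) (S p b) q) k)).
  have := mnearI (mnear_fdom hA hB Be ep)
    (mnearI (mnear_near hA (S1 p a ep)) (mnear_near hA (S1 p b ep))).
  apply: mnearS => q [eq [Ha Hb]].
  by rewrite (key q (S p a) (S p b) a b) //; exact: sS.
have sbr : smooth (br (S p a) (S p b)) by apply: (la_closed hL); exact: sS.
exact: ((global_sectionP hA hB _).1 sbr p e Be ep k).
Qed.

End StructureFunctions.

(** * The charts of E* x R *)

Lemma scalar_eq (R : realType) (V : lmodType R) (f g : {scalar V}) : f =1 g -> f = g.
Proof.
move: f g => [f [[f0] [fD]]] [g [[g0] [gD]]] /= /funext fg.
by subst g; rewrite (Prop_irrelevance f0 g0) (Prop_irrelevance fD gD).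
Qed.

Section DualAtlas.
Context {R : realType} {n m : nat} {Q : Type} {E : Q -> lmodType R}.
Implicit Types (c : chart R Q n) (e : frame 'I_m E) (p : dualR E) (q : Q).

Lemma dr_chart_q c e p i : cmap (dr_chart c e) p 0 (idx_q i) = cmap c (dr_base p) 0 i.
Proof. by rewrite /= /idx_q !row_mxEl. Qed.

Lemma dr_chart_y c e p a :
  cmap (dr_chart c e) p 0 (idx_y a) = dr_cov p (fvec e a (dr_base p)).
Proof. by rewrite /= /idx_y row_mxEl row_mxEr mxE. Qed.

Lemma dr_chart_s c e p : cmap (dr_chart c e) p 0 (idx_s) = dr_s p.
Proof. by rewrite /= /idx_s row_mxEr mxE. Qed.

Variant idx_spec : 'I_(n + m + 1) -> Prop :=
| IdxQ i : idx_spec (idx_q i)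
| IdxY a : idx_spec (idx_y a)
| IdxS : idx_spec (idx_s).

Lemma idxP j : idx_spec j.
Proof.
case: (split_ordP j) => [k ->|k ->].
  by case: (split_ordP k) => l ->; constructor.
by rewrite [k]ord1; constructor.
Qed.

Lemma idx_ind (P : 'I_(n + m + 1) -> Prop) : (forall i, P (idx_q i)) ->
  (forall a, P (idx_y a)) -> P (idx_s) -> forall j, P j.
Proof. by move=> Hq Hy Hs j; case: (idxP j). Qed.

Lemma idx_sum (F : 'I_(n + m + 1) -> R) :
  \sum_j F j = \sum_i F (idx_q i) + \sum_a F (idx_y a) + F (idx_s).
Proof. by rewrite big_split_ord big_split_ord big_ord1. Qed.

Variables (A : set (chart R Q n)) (hA : smooth_atlas A).
Variables (B : set (frame 'I_m E)) (hB : smooth_frames A B).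
Local Notation AD := (dr_atlas A B).

Lemma scalar_exists e q (y : 'I_m -> R) : B e -> fdom e q ->
  exists f : {scalar E q}, forall a, f (fvec e a q) = y a.
Proof.
move=> Be eq; have he := fr_frame hB Be.
pose F (u : E q) := \sum_a fcoord e u a * y a.
have FL : linear_for *%R (F : E q -> R).
  move=> k u v; rewrite /F mulr_sumr -big_split; apply: eq_bigr => a _.
  by rewrite (fcoordD he) // (fcoordZ he) // mulrDl -mulrA.
pose FM := GRing.isLinear.Build R (E q) R *%R F FL.
pose f : {scalar E q} := HB.pack F FM.
exists f => a; rewrite /f /= /F (bigD1 a) //= (fcoord_fvec he) // eqxx mul1r.
rewrite big1 ?addr0 // => b ba.
by rewrite (fcoord_fvec he) // eq_sym (negbTE ba) mul0r.
Qed.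

Lemma scalar_frame_eq e q (f g : {scalar E q}) : B e -> fdom e q ->
  (forall a, f (fvec e a q) = g (fvec e a q)) -> f = g.
Proof.
move=> Be eq fg; have he := fr_frame hB Be; apply: scalar_eq => u.
rewrite (fcoordE he u eq) !linear_sum; apply: eq_bigr => a _.
by rewrite !linearZ /= fg.
Qed.

Lemma scalar_fcoord e p (u : E (dr_base p)) : B e -> fdom e (dr_base p) ->
  dr_cov p u = \sum_a fcoord e u a * dr_cov p (fvec e a (dr_base p)).
Proof.
move=> Be ep; have he := fr_frame hB Be.
rewrite {1}(fcoordE he u ep) linear_sum; apply: eq_bigr => a _.
by rewrite linearZ.
Qed.

Definition dr_proj (x : 'rV[R]_(n + m + 1)) : 'rV[R]_n := \row_i x 0 (idx_q i).

Lemma continuous_dr_proj x : {for x, continuous dr_proj}.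
Proof. by apply: continuous_row => i; exact: coord_continuous. Qed.

Lemma dr_proj_chart c e p : dr_proj (cmap (dr_chart c e) p) = cmap c (dr_base p).
Proof. by apply/rowP => i; rewrite mxE dr_chart_q. Qed.

(** A frame of E identifies each fibre of E* x R with R^m x R, so that the
    image is a cylinder. *)
Lemma dr_chart_image c e (W : set Q) : B e -> W `<=` fdom e ->
  cmap (dr_chart c e) @` (@dr_pi R Q E @^-1` W `&` cdom (dr_chart c e)) =
  dr_proj @^-1` (cmap c @` (W `&` cdom c)).
Proof.
move=> Be We; apply/seteqP; split=> [_ [p [Wp [cp ep]] <-]|x [q [Wq cq] xq]].
  by exists (dr_base p); [split | rewrite dr_proj_chart].
have [f fy] := scalar_exists (fun a => x 0 (idx_y a)) Be (We _ Wq).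
exists (DualR f (x 0 idx_s)); first by split => //; split => //; exact: We.
apply/rowP => j; case: (idxP j) => [i|a|].
- by rewrite dr_chart_q /= xq mxE.
- by rewrite dr_chart_y /= fy.
- by rewrite dr_chart_s.
Qed.

Lemma open_dr_image c e (W : set Q) : A c -> B e -> mopen A W -> W `<=` fdom e ->
  open (cmap (dr_chart c e) @` (@dr_pi R Q E @^-1` W `&` cdom (dr_chart c e))).
Proof.
move=> Ac Be Wo We; rewrite dr_chart_image //.
by apply: open_comp; [move=> x _; exact: continuous_dr_proj | exact: Wo].
Qed.

Lemma is_chart_dr c e : A c -> B e -> is_chart (dr_chart c e).
Proof.
move=> Ac Be; have [inj _] := atlas_chart hA Ac; split.
  move=> [q f s] [q' f' s'] [/= cq eq] [cq' eq'] H.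
  have Hq : q = q'.
    apply: inj => //; apply/rowP => i.
    by have := congr1 (fun x : 'rV[R]_(n + m + 1) => x 0 (idx_q i)) H; rewrite !row_mxEl.
  subst q'; congr DualR.
    apply: (scalar_frame_eq Be eq) => a.
    have := congr1 (fun x : 'rV[R]_(n + m + 1) => x 0 (idx_y a)) H.
    by rewrite !row_mxEl !row_mxEr !mxE.
  have := congr1 (fun x : 'rV[R]_(n + m + 1) => x 0 idx_s) H.
  by rewrite !row_mxEr !mxE.
have [eo _] := fr_frame hB Be.
have := open_dr_image Ac Be eo (fun q => id).
congr (open (_ @` _)); apply/seteqP; split => [p [] //|p [cp ep]].
by split.
Qed.

Lemma chart_smooth_dr_pi c e f p : A c -> B e -> cdom (dr_chart c e) p ->
  smooth_at A f (dr_base p) -> chart_smooth (dr_chart c e) (fun p => f (dr_base p)) p.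
Proof.
move=> Ac Be dp sf; have [cp ep] := dp; have [U [Uo Up UI sU]] := sf c Ac cp.
have Vo : open (dr_proj @^-1` U).
  by apply: open_comp => // x _; exact: continuous_dr_proj.
apply: (@chart_smooth_intro _ _ _ _ _ _ (dr_proj @^-1` U) (fun x => crep c f (dr_proj x))) => //.
- exact: is_chart_dr.
- by rewrite /= dr_proj_chart.
- apply: smooth_gen_on => //.
  apply: (gen_comp (V := U) (phi := fun i x => x 0 (idx_q i))) => // i.
  by constructor; exact: smooth_on_coord.
- move=> p' [cp' ep'] _; rewrite dr_proj_chart crep_cmap //; exact: atlas_chart Ac.
Qed.

Lemma chart_near_dr_pi c e (P : set Q) p : A c -> B e -> cdom (dr_chart c e) p ->
  mnear A (dr_base p) P -> chart_near (dr_chart c e) p (fun p => P (dr_base p)).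
Proof.
move=> Ac Be [cp ep] HP; have HPc := HP c Ac cp.
have ct : dr_proj @ cmap (dr_chart c e) p --> cmap c (dr_base p).
  by rewrite -(dr_proj_chart c e); exact: continuous_dr_proj.
have H : \forall x \near cmap (dr_chart c e) p,
    forall q, cdom c q -> cmap c q = dr_proj x -> P q := ct _ HPc.
rewrite /chart_near; apply: filterS H => x Hx p' [cp' ep'] xp'.
by apply: Hx => //; rewrite -xp' dr_proj_chart.
Qed.

(** The fibre coordinates of two frames are related by the transition matrix of
    the bundle, whose entries are smooth on the base. *)
Lemma compatible_dr c e c' e' : A c -> A c' -> B e -> B e' ->
  compatible (dr_chart c e) (dr_chart c' e').
Proof.
move=> Ac Ac' Be Be'; have [eo _] := fr_frame hB Be; have [eo' _] := fr_frame hB Be'.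
split.
  have := open_dr_image Ac Be (mopenI hA (mopenI hA eo eo') (mopen_cdom hA Ac'))
    (fun q => fun H => H.1.1).
  congr (open (_ @` _)); apply/seteqP; split.
    by move=> p [[[ep e'p] c'p] [cp _]]; split; split.
  by move=> p [[cp ep] [c'p e'p]]; split; split.
move=> j s _ [p [dp d'p] <-]; have [cp ep] := dp; have [c'p e'p] := d'p.
have hd := is_chart_dr Ac Be.
suff [U [Uo Up _ sU]] : chart_smooth (dr_chart c e) (fun p => cmap (dr_chart c' e') p 0 j) p.
  exact: sU.
case: (idxP j) => [i|a|].
- rewrite (_ : (fun _ => _) = (fun p => (fun q => cmap c' q 0 i) (dr_base p))).
    by apply: (chart_smooth_dr_pi (f := fun q => cmap c' q 0 i)) => //; exact: smooth_at_coord.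
  by apply/funext => p'; rewrite dr_chart_q.
- rewrite (_ : (fun _ => _) = (fun p => dr_cov p (fvec e' a (dr_base p)))); last first.
    by apply/funext => p'; rewrite dr_chart_y.
  apply: (chart_smooth_eq (f := fun p => \sum_b fcoord e (fvec e' a (dr_base p)) b
      * cmap (dr_chart c e) p 0 (idx_y b))) => //.
    apply: chart_nearS (chart_near_dr_pi Ac Be dp (mnear_fdom hA hB Be ep)) => p' _ ep'.
    rewrite (scalar_fcoord _ Be) //; apply: eq_bigr => b _.
    by rewrite dr_chart_y.
  apply: chart_smooth_sum => // b; apply: chart_smooth_mul => //; last exact: chart_smooth_coord.
  apply: (chart_smooth_dr_pi (f := fun q => fcoord e (fvec e' a q) b)) => //.
  exact: (section_smooth_at_fvec hA hB a Be' e'p).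
- rewrite (_ : (fun _ => _) = (fun p => cmap (dr_chart c e) p 0 idx_s)).
    exact: chart_smooth_coord.
  by apply/funext => p'; rewrite !dr_chart_s.
Qed.

Lemma dr_smooth_atlas : smooth_atlas AD.
Proof.
split.
- by move=> _ [c [e [Ac Be ->]]]; exact: is_chart_dr.
- move=> p; have [c Ac cp] := atlas_cover hA (dr_base p).
  have [e Be ep] := fr_cover hB (dr_base p).
  by exists (dr_chart c e) => //; exists c, e.
- move=> _ _ [c [e [Ac Be ->]]] [c' [e' [Ac' Be' ->]]]; exact: compatible_dr.
Qed.

Lemma dr_atlas_chart c e : A c -> B e -> AD (dr_chart c e).
Proof. by move=> Ac Be; exists c, e. Qed.

Lemma smooth_at_dr_pi f p : smooth_at A f (dr_base p) -> smooth_at AD (fun p => f (dr_base p)) p.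
Proof. by move=> sf _ [c [e [Ac Be ->]]] dp; exact: chart_smooth_dr_pi. Qed.

Lemma mnear_dr_pi (P : set Q) p : mnear A (dr_base p) P ->
  mnear AD p (fun p => P (dr_base p)).
Proof. by move=> HP _ [c [e [Ac Be ->]]] dp; exact: chart_near_dr_pi. Qed.

Lemma smooth_at_dr_coord c e j p : A c -> B e -> cdom (dr_chart c e) p ->
  smooth_at AD (fun p => cmap (dr_chart c e) p 0 j) p.
Proof. by move=> Ac Be; apply: (smooth_at_coord dr_smooth_atlas); exact: dr_atlas_chart. Qed.

End DualAtlas.

(** * Frames of the prolongation *)

Local Notation tval := Defs.tval.

Section Prolongation.
Context {R : realType} {n m : nat} {Q : Type} {E : Q -> lmodType R}.
Variables (A : set (chart R Q n)) (hA : smooth_atlas A).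
Variables (B : set (frame 'I_m E)) (hB : smooth_frames A B).
Variable rho : forall q, {linear E q -> tspace A q}.
Hypothesis rho_smooth : forall W s, mopen A W -> smooth_section A B W s ->
    smooth_vfield W (fun p => rho p (s p)).
Implicit Types (c : chart R Q n) (e : frame 'I_m E) (p : dualR E) (q : Q).
Local Notation AD := (dr_atlas A B).
Local Notation P := (prol B rho : dualR E -> lmodType R).
Let hAD := dr_smooth_atlas hA hB.

Lemma cpder_dr_pi c e f j p : A c -> B e -> cdom (dr_chart c e) p ->
  smooth_at A f (dr_base p) ->
  cpder (dr_chart c e) (fun p => f (dr_base p)) j p =
  \sum_i (idx_q i == j)%:R * cpder c f i (dr_base p).
Proof.
move=> Ac Be dp sf; have [cp ep] := dp; have [U [Uo Up UI sU]] := sf c Ac cp.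
have Vo : open (@dr_proj R n m @^-1` U).
  by apply: open_comp => // x _; exact: continuous_dr_proj.
have hd := is_chart_dr hA hB Ac Be.
rewrite (@cpder_intro _ _ _ _ _ _ _ (@dr_proj R n m @^-1` U)
  (fun x => crep c f (dr_proj x))) //; first last.
- by move=> p' [cp' ep'] _; rewrite dr_proj_chart crep_cmap //; exact: atlas_chart Ac.
- by rewrite /= dr_proj_chart.
have Ut : U (dr_proj (cmap (dr_chart c e) p)) by rewrite dr_proj_chart.
have dt i : is_derive (cmap (dr_chart c e) p) (delta_mx 0 j)
    (fun x => dr_proj x 0 i : R) (idx_q i == j)%:R.
  rewrite (_ : (fun x => _) = (fun x : 'rV[R]_(n + m + 1) => x 0 (idx_q i))); last first.
    by apply/funext => x; rewrite mxE.
  have := is_derive_coord (cmap (dr_chart c e) p) (delta_mx 0 j) (idx_q i).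
  by rewrite mxE eqxx.
have [_ H] := is_derive_smooth_comp Uo sU Ut dt.
by apply: etrans H _; rewrite dr_proj_chart.
Qed.

Lemma tapp_dr_pi c e p (v : tspace AD p) f : A c -> B e -> cdom (dr_chart c e) p ->
  smooth_at A f (dr_base p) ->
  tapp v (fun p => f (dr_base p)) =
  \sum_i v (dr_chart c e) 0 (idx_q i) * cpder c f i (dr_base p).
Proof.
move=> Ac Be dp sf.
rewrite (tappE hAD v (dr_atlas_chart Ac Be) dp); last exact: smooth_at_dr_pi.
under eq_bigr => j _ do rewrite (cpder_dr_pi _ Ac Be dp sf) mulr_sumr.
rewrite exchange_big /=; apply: eq_bigr => i _.
rewrite (bigD1 (idx_q i)) //= eqxx mul1r big1 ?addr0 // => j ji.
by rewrite eq_sym (negbTE ji) mul0r mulr0.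
Qed.

Lemma prol_anchor_q c e p (u : P p) i : A c -> B e -> cdom (dr_chart c e) p ->
  tval (pval u).2 (dr_chart c e) 0 (idx_q i) = rho (dr_pi p) (pval u).1 c 0 i.
Proof.
move=> Ac Be dp; have [cp ep] := dp; have /asboolP H := pvalP u.
rewrite (H c Ac cp i) -(tapp_coord hAD _ (idx_q i) (dr_atlas_chart Ac Be) dp).
by congr tapp; apply/funext => p'; rewrite dr_chart_q.
Qed.

(** The defining condition of the prolongation prescribes the q-components of
    the tangent vector and leaves the others free. *)
Lemma prol_exists c e p (a : E (dr_pi p)) (x : 'rV[R]_(n + m + 1)) :
  A c -> B e -> cdom (dr_chart c e) p ->
  (forall i, x 0 (idx_q i) = rho (dr_pi p) a c 0 i) ->
  exists u : P p, (pval u).1 = a /\ tval (pval u).2 (dr_chart c e) = x.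
Proof.
move=> Ac Be dp xa; have [cp ep] := dp.
have [v vx] := tvec_exists hAD x (dr_atlas_chart Ac Be) dp.
have H : (a, v) \in @prol_pred R n m Q E A B rho p.
  apply/asboolP => c' Ac' c'p i /=.
  rewrite (tapp_dr_pi (f := fun q => cmap c' q 0 i) _ Ac Be dp); last exact: smooth_at_coord.
  rewrite (tval_change _ Ac Ac' cp c'p) mxE.
  by apply: eq_bigr => k _; rewrite -xa vx mxE.
by exists (Prol H).
Qed.

Lemma prol_eltP c e p (a : E (dr_pi p)) (x : 'rV[R]_(n + m + 1)) :
  A c -> B e -> cdom (dr_chart c e) p ->
  (forall i, x 0 (idx_q i) = rho (dr_pi p) a c 0 i) ->
  let u := prol_elt B rho (dr_chart c e) a x in
  (pval u).1 = a /\ tval (pval u).2 (dr_chart c e) = x.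
Proof.
move=> Ac Be dp xa; have [u Hu] := prol_exists Ac Be dp xa.
rewrite /prol_elt; set S := [set u : P p | _].
have [[w Hw ->]|[H _]] := pickoptP S; first exact: Hw.
by case: (H u).
Qed.

(** The q-components of the anchor are left out: they are determined by the
    part in E. *)
Definition prol_comp c e p (u : P p) (k : prol_idx) : R :=
  match k with
  | inl (inl a) => fcoord e (pval u).1 a
  | inl (inr a) => tval (pval u).2 (dr_chart c e) 0 (idx_y a)
  | inr _ => tval (pval u).2 (dr_chart c e) 0 idx_s
  end.

Lemma prol_comp_linear c e p k (u w : P p) l : B e -> fdom e (dr_base p) ->
  prol_comp c e (k *: u + w) l = k * prol_comp c e u l + prol_comp c e w l.
Proof.
move=> Be ep; have he := fr_frame hB Be.
have H j : tval (pval (k *: u + w)).2 (dr_chart c e) 0 j =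
    k * tval (pval u).2 (dr_chart c e) 0 j + tval (pval w).2 (dr_chart c e) 0 j.
  rewrite -[LHS]/((k *: tval (pval u).2 (dr_chart c e) + tval (pval w).2 (dr_chart c e)) 0 j).
  by rewrite !mxE.
case: l => [[a|a]|[]] /=.
- rewrite -(fcoordZ he) // -(fcoordD he) //.
- exact: H.
- exact: H.
Qed.

Lemma prol_comp_eq c e p (u w : P p) : A c -> B e -> cdom (dr_chart c e) p ->
  (forall k, prol_comp c e u k = prol_comp c e w k) -> u = w.
Proof.
move=> Ac Be dp uw; have [cp ep] := dp; have he := fr_frame hB Be.
have E1 : (pval u).1 = (pval w).1.
  rewrite (fcoordE he (pval u).1 ep) (fcoordE he (pval w).1 ep).
  by apply: eq_bigr => a _; have /= -> := uw (inl (inl a)).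
have E2 : (pval u).2 = (pval w).2.
  apply: (tspace_eq (dr_atlas_chart Ac Be) dp); apply/rowP.
  apply: idx_ind => [i|a|].
  - by rewrite !(prol_anchor_q _ _ Ac Be dp) E1.
  - exact: (uw (inl (inr a))).
  - exact: (uw (inr tt)).
apply: val_inj => /=.
by rewrite [LHS]surjective_pairing [RHS]surjective_pairing E1 E2.
Qed.

Section Frame.
Variables (c : chart R Q n) (e : frame 'I_m E).
Hypotheses (Ac : A c) (Be : B e).
Local Notation d := (dr_chart c e).
Local Notation F := (prol_frame B rho c e).

Definition prol_frame_vec (k : prol_idx) q : 'rV[R]_(n + m + 1) :=
  match k with
  | inl (inl a) => \sum_(i < n) rho q (fvec e a q) c 0 i *: delta_mx 0 (idx_q i)
  | inl (inr a) => delta_mx 0 (idx_y a)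
  | inr _ => delta_mx 0 idx_s
  end.

Definition prol_frame_base (k : prol_idx) q : E q :=
  if k is inl (inl a) then fvec e a q else 0.

Lemma prol_frame_vec_q k q i :
  prol_frame_vec k q 0 (idx_q i) = rho q (prol_frame_base k q) c 0 i.
Proof.
case: k => [[a|a]|[]] /=; rewrite ?linear0.
- rewrite summxE (bigD1 i) //= !mxE !eqxx mulr1 big1 ?addr0 // => j ji.
  rewrite !mxE eqxx /= (_ : _ == _ = false) ?mulr0 //.
  by apply/negbTE; apply: contra ji => /eqP /lshift_inj /lshift_inj ->.
- by rewrite !mxE /= eq_lshift eq_lrshift.
- by rewrite !mxE /= eq_lrshift.
Qed.

Lemma prol_frame_vec_y k q a :
  prol_frame_vec k q 0 (idx_y a) = (k == inl (inr a))%:R.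
Proof.
case: k => [[b|b]|[]] /=.
- rewrite summxE big1 // => j _; by rewrite !mxE /= eq_lshift eq_rlshift mulr0.
- by rewrite !mxE /= eq_lshift eq_rshift eq_sym.
- by rewrite !mxE /= eq_lrshift.
Qed.

Lemma prol_frame_vec_s k q :
  prol_frame_vec k q 0 idx_s = (k == inr tt)%:R.
Proof.
case: k => [[b|b]|[]] /=.
- rewrite summxE big1 // => j _; by rewrite !mxE /= eq_rlshift mulr0.
- by rewrite !mxE /= eq_rlshift.
- by rewrite !mxE /= eqxx.
Qed.

Lemma prol_frameP p k : cdom d p ->
  (pval (fvec F k p)).1 = prol_frame_base k (dr_pi p) /\
  tval (pval (fvec F k p)).2 d = prol_frame_vec k (dr_pi p).
Proof.
move=> dp; case: k => [[a|a]|[]]; apply: (prol_eltP Ac Be dp) => i.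
- exact: (prol_frame_vec_q (inl (inl a))).
- exact: (prol_frame_vec_q (inl (inr a))).
- exact: (prol_frame_vec_q (inr tt)).
Qed.

Lemma prol_comp_frame p k l : cdom d p -> prol_comp c e (fvec F k p) l = (k == l)%:R.
Proof.
move=> dp; have he := fr_frame hB Be; have [cp ep] := dp.
have [E1 E2] := prol_frameP k dp.
case: l => [[a|a]|[]] /=; rewrite ?E1 ?E2 ?prol_frame_vec_y ?prol_frame_vec_s //.
case: k {E1 E2} => [[b|b]|[]] /=; rewrite ?(fcoord0 he) ?(fcoord_fvec he) //.
Qed.

Lemma prol_comp_sum p (x : prol_idx -> R) l : cdom d p ->
  prol_comp c e (\sum_k x k *: fvec F k p) l = x l.
Proof.
move=> dp; have [cp ep] := dp.
have H (r : seq prol_idx) : prol_comp c e (\sum_(k <- r) x k *: fvec F k p) l =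
    \sum_(k <- r) x k * (k == l)%:R.
  elim: r => [|k r IH].
    have := prol_comp_linear c (-1) (0 : P p) 0 l Be ep.
    by rewrite !big_nil scaler0 addr0 mulN1r addNr.
  by rewrite !big_cons prol_comp_linear // IH prol_comp_frame.
rewrite H (bigD1 l) //= eqxx mulr1 big1 ?addr0 // => k kl.
by rewrite (negbTE kl) mulr0.
Qed.

Lemma prol_compE p (u : P p) : cdom d p -> u = \sum_k prol_comp c e u k *: fvec F k p.
Proof. by move=> dp; apply: (prol_comp_eq Ac Be dp) => k; rewrite prol_comp_sum. Qed.

Lemma is_frame_prol : is_frame AD F.
Proof.
split; first by apply: (mopen_cdom hAD); exact: dr_atlas_chart.
move=> p dp u; exists [ffun k => prol_comp c e u k]; split.
  by rewrite {1}(prol_compE u dp); apply: eq_bigr => k _; rewrite ffunE.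
move=> x ux; apply/ffunP => k; rewrite ffunE ux.
exact: (prol_comp_sum (fun k => x k)).
Qed.

Lemma fcoord_prol p (u : P p) k : cdom d p -> fcoord F u k = prol_comp c e u k.
Proof.
move=> dp; apply: (fcoord_unique is_frame_prol (g := prol_comp c e u)) => //.
exact: prol_compE.
Qed.

Lemma mnear_chart p : cdom d p -> mnear AD p (cdom d).
Proof. by move=> dp; apply: (mnear_cdom hAD) => //; exact: dr_atlas_chart. Qed.

Lemma smooth_at_rho a i q : cdom c q -> fdom e q ->
  smooth_at A (fun q => rho q (fvec e a q) c 0 i) q.
Proof.
move=> cq eq; have [eo _] := fr_frame hB Be.
have ece := mopenI hA eo (mopen_cdom hA Ac).
apply: (smooth_funP _ ece).1 (conj eq cq).
exact: (rho_smooth eo (fr_compat hB Be a)).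
Qed.

Lemma smooth_at_prol_frame_tval k p j : cdom d p ->
  smooth_at AD (fun p => tval (pval (fvec F k p)).2 d 0 j) p.
Proof.
move=> dp; have [cp ep] := dp.
apply: (smooth_at_eq hAD (f := fun p => prol_frame_vec k (dr_pi p) 0 j)).
  by apply: mnearS (mnear_chart dp) => p' dp'; have [_ ->] := prol_frameP k dp'.
apply: (smooth_at_dr_pi hA hB (f := fun q => prol_frame_vec k q 0 j)).
case: (idxP j) => [i|a|].
- rewrite (_ : (fun _ => _) = (fun q => rho q (prol_frame_base k q) c 0 i)); last first.
    by apply/funext => q; rewrite prol_frame_vec_q.
  case: k => [[a|a]|[]] /=; first exact: smooth_at_rho.
    rewrite (_ : (fun _ => _) = (fun q => 0)); first exact: smooth_at_cst.
    by apply/funext => q; rewrite linear0 mxE.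
  rewrite (_ : (fun _ => _) = (fun q => 0)); first exact: smooth_at_cst.
  by apply/funext => q; rewrite linear0 mxE.
- rewrite (_ : (fun _ => _) = (fun q => (k == inl (inr a))%:R)); first exact: smooth_at_cst.
  by apply/funext => q; rewrite prol_frame_vec_y.
- rewrite (_ : (fun _ => _) = (fun q => (k == inr tt)%:R)); first exact: smooth_at_cst.
  by apply/funext => q; rewrite prol_frame_vec_s.
Qed.

End Frame.

(** The tangent parts in two charts differ by the Jacobian matrix, whose
    entries are smooth as partial derivatives of smooth functions. *)
Lemma smooth_at_prol_comp_frame c e c' e' k l p : A c -> B e -> A c' -> B e' ->
  cdom (dr_chart c e) p -> cdom (dr_chart c' e') p ->
  smooth_at AD (fun p => prol_comp c' e' (fvec (prol_frame B rho c e) k p) l) p.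
Proof.
move=> Ac Be Ac' Be' dp d'p; have [cp ep] := dp; have [c'p e'p] := d'p.
have he' := fr_frame hB Be'.
have change j : smooth_at AD (fun p => tval (pval (fvec (prol_frame B rho c e) k p)).2
    (dr_chart c' e') 0 j) p.
  apply: (smooth_at_eq hAD (f := fun p =>
      \sum_i tval (pval (fvec (prol_frame B rho c e) k p)).2 (dr_chart c e) 0 i *
        cpder (dr_chart c e) (fun p => cmap (dr_chart c' e') p 0 j) i p)).
    apply: mnearS (mnearI (mnear_chart Ac Be dp) (mnear_chart Ac' Be' d'p)).
    move=> p' [dp' d'p'].
    rewrite (tval_change _ (dr_atlas_chart Ac Be) (dr_atlas_chart Ac' Be') dp' d'p') [RHS]mxE.
    by apply: eq_bigr => i _; rewrite [in RHS]mxE.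
  apply: (smooth_at_sum hAD) => i; apply: (smooth_at_mul hAD).
    exact: smooth_at_prol_frame_tval.
  apply: (smooth_at_cpder hAD) => //; first exact: dr_atlas_chart.
  exact: smooth_at_dr_coord.
case: l => [[b|b]|[]]; [rewrite /=|exact: change..].
apply: (smooth_at_eq hAD (f := fun p => fcoord e' (prol_frame_base e k (dr_pi p)) b)).
  by apply: mnearS (mnear_chart Ac Be dp) => p' dp'; have [-> _] := prol_frameP Ac Be k dp'.
apply: (smooth_at_dr_pi hA hB (f := fun q => fcoord e' (prol_frame_base e k q) b)).
case: k {change} => [[a|a]|[]] /=.
- exact: (section_smooth_at_fvec hA hB a Be ep).
- apply: (smooth_at_eq hA (f := fun=> 0)); last exact: smooth_at_cst.
  by apply: mnearS (mnear_fdom hA hB Be' e'p) => q eq; rewrite (fcoord0 he').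
- apply: (smooth_at_eq hA (f := fun=> 0)); last exact: smooth_at_cst.
  by apply: mnearS (mnear_fdom hA hB Be' e'p) => q eq; rewrite (fcoord0 he').
Qed.

Lemma prol_smooth_frames : smooth_frames AD (prol_frames B rho).
Proof.
split.
- by move=> _ [c [e [Ac Be ->]]]; exact: is_frame_prol.
- move=> p; have [c Ac cp] := atlas_cover hA (dr_base p).
  have [e Be ep] := fr_cover hB (dr_base p).
  by exists (prol_frame B rho c e); [exists c, e | split].
- move=> _ [c [e [Ac Be ->]]] k _ [c' [e' [Ac' Be' ->]]].
  (* These functions are the coefficients of the frame of (c, e) in that of
     (c', e'). *)
  exists (fun l p => prol_comp c' e' (fvec (prol_frame B rho c e) k p) l); split.
    move=> l; have o1 := mopen_cdom hAD (dr_atlas_chart Ac Be).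
    have o2 := mopen_cdom hAD (dr_atlas_chart Ac' Be').
    apply/(smooth_funP _ (mopenI hAD o1 o2)) => p [dp d'p].
    exact: smooth_at_prol_comp_frame.
  by move=> p dp d'p; exact: prol_compE.
Qed.

End Prolongation.

(** * The contact form *)

Lemma tapp_opp (R : realType) (M : Type) (n : nat) (A : set (chart R M n)) p
    (v : tspace A p) f : smooth_atlas A -> smooth_at A f p ->
  tapp v (fun q => - f q) = - tapp v f.
Proof.
move=> hA sf; rewrite (_ : (fun _ => _) = (fun q => -1 * f q)); last first.
  by apply/funext => q; rewrite mulN1r.
rewrite (tapp_mul hA); [|exact: smooth_at_cst|exact: sf].
by rewrite (tapp_cst hA) mulr0 addr0 mulN1r.
Qed.

Section ContactForm.
Context {R : realType} {n m : nat} {Q : Type} {E : Q -> lmodType R}.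
Variables (A : set (chart R Q n)) (hM : is_manifold A).
Variables (B : set (frame 'I_m E)) (hB : smooth_frames A B).
Variable rho : forall q, {linear E q -> tspace A q}.
Variable br : section E -> section E -> section E.
Hypothesis hL : is_lie_algebroid B rho br.
Variable brP : prol_section B rho -> prol_section B rho -> prol_section B rho.
Hypothesis hP : is_prol_bracket br brP.
Implicit Types (c : chart R Q n) (e : frame 'I_m E) (p : dualR E) (q : Q).
Local Notation AD := (dr_atlas A B).
Local Notation P := (prol B rho : dualR E -> lmodType R).
Local Notation eta := (contact_eta B rho).
Local Notation smooth := (smooth_section AD (prol_frames B rho) setT).
Local Notation deta := (ext_d1 (prol_anchor B rho) brP eta).
Local Notation rho_smooth := (la_anchor_smooth hL).
Let hA := manifold_atlas hM.
Let hAD := dr_smooth_atlas hA hB.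
Let hBP := prol_smooth_frames hA hB rho_smooth.
Let hLP := prol_lie_algebroid hP.

Lemma prol_idx_sum (F : prol_idx -> R) :
  \sum_(k : @prol_idx m) F k =
  \sum_a F (inl (inl a)) + \sum_a F (inl (inr a)) + F (inr tt).
Proof.
rewrite big_sumType big_sumType; congr (_ + _).
by rewrite (big_pred1 tt) // => -[].
Qed.

Definition eta_comp e (k : @prol_idx m) p : R :=
  match k with
  | inl (inl a) => - dr_cov p (fvec e a (dr_base p))
  | inl (inr a) => 0
  | inr _ => 1
  end.

Lemma eta_linear p k (u w : P p) : eta p (k *: u + w) = k * eta p u + eta p w.
Proof.
rewrite /contact_eta /liouville linearP tapp_linear.
rewrite -[(pval _).1]/(k *: (pval u).1 + (pval w).1) linearP /=.
by rewrite mulrBr opprD addrACA.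
Qed.

Lemma eta0 p : eta p 0 = 0.
Proof. exact: form0 eta_linear p. Qed.

Lemma tapp_dr_s c e p (v : tspace AD p) : A c -> B e -> cdom (dr_chart c e) p ->
  tapp v (@dr_s R Q E) = v (dr_chart c e) 0 idx_s.
Proof.
move=> Ac Be dp; rewrite -(tapp_coord hAD _ idx_s (dr_atlas_chart Ac Be) dp).
by congr tapp; apply/funext => p'; rewrite dr_chart_s.
Qed.

Lemma tapp_dr_y c e p (v : tspace AD p) a : A c -> B e -> cdom (dr_chart c e) p ->
  tapp v (fun p => dr_cov p (fvec e a (dr_base p))) = v (dr_chart c e) 0 (idx_y a).
Proof.
move=> Ac Be dp; rewrite -(tapp_coord hAD _ (idx_y a) (dr_atlas_chart Ac Be) dp).
by congr tapp; apply/funext => p'; rewrite dr_chart_y.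
Qed.

Lemma smooth_at_dr_y c e p a : A c -> B e -> cdom (dr_chart c e) p ->
  smooth_at AD (fun p => dr_cov p (fvec e a (dr_base p))) p.
Proof.
move=> Ac Be dp; rewrite (_ : (fun _ => _) = (fun p => cmap (dr_chart c e) p 0 (idx_y a))).
  exact: smooth_at_dr_coord.
by apply/funext => p'; rewrite dr_chart_y.
Qed.

Lemma smooth_at_eta_comp c e k p : A c -> B e -> cdom (dr_chart c e) p -> smooth_at AD (eta_comp e k) p.
Proof.
move=> Ac Be dp; case: k => [[a|a]|[]].
- exact: (smooth_at_opp hAD (smooth_at_dr_y a Ac Be dp)).
- by rewrite /=; exact: smooth_at_cst.
- by rewrite /=; exact: smooth_at_cst.
Qed.

Section InChart.
Variables (c : chart R Q n) (e : frame 'I_m E).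
Hypotheses (Ac : A c) (Be : B e).
Local Notation d := (dr_chart c e).
Local Notation F := (prol_frame B rho c e).

Lemma eta_frame p k : cdom d p -> eta p (fvec F k p) = eta_comp e k p.
Proof.
move=> dp; rewrite /contact_eta /liouville (tapp_dr_s _ Ac Be dp).
have [E1 E2] := prol_frameP hA hB rho Ac Be k dp.
rewrite -[prol_anchor _ _ _ _]/(pval (fvec F k p)).2 E1 E2 prol_frame_vec_s.
by case: k {E1 E2} => [[a|a]|[]] /=; rewrite ?eqxx ?linear0 ?oppr0 ?addr0 ?add0r.
Qed.

Lemma eta_prol_comp p (u : P p) : cdom d p ->
  eta p u = \sum_k prol_comp c e u k * eta_comp e k p.
Proof.
move=> dp; rewrite {1}(prol_compE hA hB Ac Be u dp).
elim/big_ind2: _ => [|x x' y y' Hx Hy|k _]; first exact: eta0.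
  by rewrite (formD eta_linear) Hx Hy.
by rewrite (formZ eta_linear) eta_frame.
Qed.

End InChart.

Lemma eta_smooth s : smooth s -> forall p, smooth_at AD (fun p => eta p (s p)) p.
Proof.
move=> ss p; have [c Ac cp] := atlas_cover hA (dr_base p).
have [e Be ep] := fr_cover hB (dr_base p).
have dp : cdom (dr_chart c e) p by split.
have PF : prol_frames B rho (prol_frame B rho c e) by exists c, e.
apply: (smooth_at_eq hAD (f := fun p =>
   \sum_k fcoord (prol_frame B rho c e) (s p) k * eta_comp e k p)).
  apply: mnearS (mnear_chart hA hB Ac Be dp) => p' dp'.
  rewrite (eta_prol_comp Ac Be) //; apply: eq_bigr => k _.
  by rewrite (fcoord_prol hA hB Ac Be).
apply: (smooth_at_sum hAD) => k; apply: (smooth_at_mul hAD); last exact: (smooth_at_eta_comp k Ac Be).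
exact: ((global_sectionP hAD hBP _).1 ss p _ PF dp).
Qed.

Lemma deta_skew s t p : smooth s -> smooth t -> deta s t p = - deta t s p.
Proof. exact: (ext_d1_skew hLP eta_linear). Qed.

Section ExteriorDerivativeInChart.
Variables (c : chart R Q n) (e : frame 'I_m E) (C : 'I_m -> 'I_m -> 'I_m -> Q -> R).
Hypotheses (Ac : A c) (Be : B e) (hC : structure_functions A B br e C).
Local Notation d := (dr_chart c e).
Local Notation F := (prol_frame B rho c e).
Let PF : prol_frames B rho F. Proof. by exists c, e. Qed.
Local Notation y p a := (dr_cov p (fvec e a (dr_base p))).

(** The matrix of the two-form
    X^a /\ V^a + (1/2) y_g C^g_ab X^a /\ X^b. *)
Definition deta_comp (k l : @prol_idx m) p : R :=
  match k, l with
  | inl (inl a), inl (inl b) => \sum_g C g a b (dr_base p) * y p g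
  | inl (inl a), inl (inr b) => (a == b)%:R
  | inl (inr a), inl (inl b) => - (a == b)%:R
  | _, _ => 0
  end.

Lemma tapp_eta_comp p k l : cdom d p ->
  tapp (prol_anchor B rho p (fvec F k p)) (eta_comp e l) =
  if l is inl (inl b) then - (k == inl (inr b))%:R else 0.
Proof.
move=> dp; case: l => [[b|b]|[]]; [|exact: (tapp_cst hAD)..].
rewrite (tapp_opp _ hAD); last exact: (smooth_at_dr_y b Ac Be dp).
rewrite (tapp_dr_y _ _ Ac Be dp).
have [_ E2] := prol_frameP hA hB rho Ac Be k dp.
by rewrite -[prol_anchor _ _ _ _]/(pval (fvec F k p)).2 E2 prol_frame_vec_y.
Qed.

(** The pullback of a function on Q suffices, as the charts of E* x R contain
    whole fibres over Q. *)
Lemma prol_cutoff p : cdom d p ->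
  exists2 f : dualR E -> R, cutoff AD f (fdom F) & mnear AD p (fun p => f p = 1).
Proof.
move=> [cp ep]; have [eo _] := fr_frame hB Be.
have [f [sf f0] f1] := cutoff_exists hM (mopenI hA (mopen_cdom hA Ac) eo) (conj cp ep).
exists (fun p => f (dr_base p)); last exact: (mnear_dr_pi (P := fun q => f q = 1) f1).
split=> [p'|p' np']; first exact: smooth_at_dr_pi.
by apply: (mnear_dr_pi (P := fun q => f q = 0)); apply: f0 => -[cp' ep']; apply: np'.
Qed.

(** The values of eta on the frame are - y_a, 0 and 1, whose derivatives along
    the frame are constant; the brackets contribute the structure functions. *)
Lemma deta_frame p f k l : cdom d p -> cutoff AD f (fdom F) ->
  mnear AD p (fun p => f p = 1) ->
  deta (fun p => f p *: fvec F k p) (fun p => f p *: fvec F l p) p = deta_comp k l p.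
Proof.
move=> dp cf f1.
have sS j : smooth (fun p => f p *: fvec F j p).
  by apply: (cutoff_section hAD hBP cf) => p' dp'; exact: section_smooth_at_fvec.
have Seta j : mnear AD p (fun p => eta p (f p *: fvec F j p) = eta_comp e j p).
  apply: mnearS (mnearI (mnear_chart hA hB Ac Be dp) f1) => p' [dp' ->].
  by rewrite scale1r eta_frame.
have fp := mnear_self hAD f1.
rewrite /ext_d1 /anchor_der !(tapp_eq hAD _ (Seta _)) fp !scale1r.
rewrite !tapp_eta_comp //.
pose U := [set p | mnear AD p (fun p => f p = 1)] `&` cdom d.
have Uo : mopen AD U.
  by apply: (mopenI hAD); [exact: mopen_mnear | exact: (mopen_cdom hAD (dr_atlas_chart Ac Be))].
have S1 j p' : U p' -> f p' *: fvec F j p' = fvec F j p'.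
  by move=> [/(mnear_self hAD) -> _]; rewrite scale1r.
have Uc : U `<=` cdom d by move=> p' [].
rewrite (prol_basis_bracket hP Ac Be hC (k := k) (l := l) Uo Uc (sS k) (sS l)
  (S1 k) (S1 l) (conj f1 dp)).
have Heta a b : eta p (\sum_(g < m) C g a b (dr_pi p) *: fvec F (inl (inl g)) p) =
    - (\sum_(g < m) C g a b (dr_base p) * y p g).
  rewrite -sumrN; elim/big_ind2: _ => [|x x' z z' Hx Hz|g _]; first exact: eta0.
    by rewrite (formD eta_linear) Hx Hz.
  by rewrite (formZ eta_linear) eta_frame // mulrN.
case: k {sS Seta S1} => [[a|a]|[]]; case: l => [[b|b]|[]];
  rewrite ?(Heta a b) ?eta0 /= ?oppr0 ?subr0 ?add0r ?addr0 ?opprK //.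
by rewrite -[inl _ == _]/(b == a) eq_sym.
Qed.

Lemma deta_formula s t p : cdom d p -> smooth s -> smooth t ->
  deta s t p = \sum_k prol_comp c e (s p) k * \sum_l prol_comp c e (t p) l * deta_comp k l p.
Proof.
move=> dp ss st; have [f cf f1] := prol_cutoff dp.
have fp := mnear_self hAD f1.
have sS j : smooth (fun p => f p *: fvec F j p).
  by apply: (cutoff_section hAD hBP cf) => p' dp'; exact: section_smooth_at_fvec.
have exp s' t' : smooth s' -> smooth t' -> deta s' t' p =
    \sum_l prol_comp c e (t' p) l * deta s' (fun p => f p *: fvec F l p) p.
  move=> ss' st'.
  rewrite (ext_d1_frame hAD hBP hLP eta_linear eta_smooth PF cf fp dp ss' st').
  by apply: eq_bigr => l _; rewrite (fcoord_prol hA hB Ac Be).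
rewrite deta_skew // exp // -sumrN; apply: eq_bigr => k _.
rewrite -mulrN -deta_skew // exp //; congr (_ * _); apply: eq_bigr => l _.
by rewrite deta_frame.
Qed.

Lemma global_extension p (u : P p) : cdom d p -> exists2 s, smooth s & s p = u.
Proof.
move=> dp; have [f cf f1] := prol_cutoff dp.
exists (fun p => f p *: \sum_k prol_comp c e u k *: fvec F k p); last first.
  by rewrite (mnear_self hAD f1) scale1r -prol_compE.
apply: (cutoff_section hAD hBP cf) => p' dp'.
apply: (section_smooth_at_sum hAD hBP) => k; apply: (section_smooth_at_scale hAD hBP); first exact: smooth_at_cst.
exact: (section_smooth_at_fvec hAD hBP k PF dp').
Qed.

End ExteriorDerivativeInChart.
End ContactForm.

(** * The Hamiltonian section *)

Section HamiltonianSection.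
Context {R : realType} {n m : nat} {Q : Type} {E : Q -> lmodType R}.
Variables (A : set (chart R Q n)) (hM : is_manifold A).
Variables (B : set (frame 'I_m E)) (hB : smooth_frames A B).
Variable rho : forall q, {linear E q -> tspace A q}.
Variable br : section E -> section E -> section E.
Hypothesis hL : is_lie_algebroid B rho br.
Variable brP : prol_section B rho -> prol_section B rho -> prol_section B rho.
Hypothesis hP : is_prol_bracket br brP.
Implicit Types (c : chart R Q n) (e : frame 'I_m E) (p : dualR E) (q : Q).
Local Notation AD := (dr_atlas A B).
Local Notation P := (prol B rho : dualR E -> lmodType R).
Local Notation eta := (contact_eta B rho).
Local Notation smooth := (smooth_section AD (prol_frames B rho) setT).
Local Notation deta := (ext_d1 (prol_anchor B rho) brP eta).
Local Notation rho_smooth := (la_anchor_smooth hL).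
Let hA := manifold_atlas hM.
Let hAD := dr_smooth_atlas hA hB.
Let hBP := prol_smooth_frames hA hB rho_smooth.
Let hLP := prol_lie_algebroid hP.

Local Notation ycoord p e a := (dr_cov p (fvec e a (dr_base p))).

Lemma deta_comp_sum c e C p (u : P p) k :
  \sum_l prol_comp c e u l * deta_comp e C k l p =
  match k with
  | inl (inl a) => prol_comp c e u (inl (inr a)) +
      \sum_(b < m) prol_comp c e u (inl (inl b)) * \sum_(g < m) C g a b (dr_base p) * ycoord p e g
  | inl (inr a) => - prol_comp c e u (inl (inl a))
  | inr _ => 0
  end.
Proof.
have delta (x : 'I_m -> R) a : \sum_b x b * (a == b)%:R = x a.
  rewrite (bigD1 a) //= eqxx mulr1 big1 ?addr0 // => b ba.
  by rewrite eq_sym (negbTE ba) mulr0.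
rewrite prol_idx_sum; case: k => [[a|a]|[]] /=.
- by rewrite mulr0 addr0 addrC delta.
- under eq_bigr do rewrite mulrN.
  rewrite sumrN delta mulr0 addr0 big1 ?addr0 // => b _; exact: mulr0.
- by rewrite mulr0 !big1 ?addr0 // => b _; exact: mulr0.
Qed.

Variable r : prol_section B rho.
Hypothesis hr : is_reeb (prol_frames B rho) (prol_anchor B rho) brP eta r.
Variable H : dualR E -> R.
Hypothesis hH : smooth_fun AD setT H.

Let sH p : smooth_at AD H p. Proof. exact: (global_funP hAD H).1. Qed.

Definition dH_frame c e (k : @prol_idx m) p : R :=
  match k with
  | inl (inl a) => \sum_(i < n) rho (dr_base p) (fvec e a (dr_base p)) c 0 i *
                                cpder (dr_chart c e) H (idx_q i) p
  | inl (inr a) => cpder (dr_chart c e) H (idx_y a) p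
  | inr _ => cpder (dr_chart c e) H idx_s p
  end.

Section InChart.
Variables (c : chart R Q n) (e : frame 'I_m E) (C : 'I_m -> 'I_m -> 'I_m -> Q -> R).
Hypotheses (Ac : A c) (Be : B e) (hC : structure_functions A B br e C).
Local Notation d := (dr_chart c e).
Local Notation F := (prol_frame B rho c e).

Lemma tapp_frame_H p k : cdom d p ->
  tapp (prol_anchor B rho p (fvec F k p)) H = dH_frame c e k p.
Proof.
move=> dp; rewrite (tappE hAD _ (dr_atlas_chart Ac Be) dp) //.
have [_ E2] := prol_frameP hA hB rho Ac Be k dp.
rewrite -[prol_anchor _ _ _ _]/(pval (fvec F k p)).2 E2 idx_sum.
have E1 := @prol_frame_vec_q R n m Q E A rho c e k (dr_pi p).
have E3 := @prol_frame_vec_y R n m Q E A rho c e k (dr_pi p).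
have E4 := @prol_frame_vec_s R n m Q E A rho c e k (dr_pi p).
have delta (x : 'I_m -> R) a : \sum_b (a == b)%:R * x b = x a.
  rewrite (bigD1 a) //= eqxx mul1r big1 ?addr0 // => b ba.
  by rewrite eq_sym (negbTE ba) mul0r.
under [X in X + _ + _]eq_bigr => i _ do rewrite E1.
under [X in _ + X + _]eq_bigr => i _ do rewrite E3.
rewrite E4; case: k {E1 E2 E3 E4} => [[a|a]|[]].
- by rewrite /= mul0r addr0 [X in _ + X]big1 ?addr0 // => b _; rewrite mul0r.
- rewrite /= mul0r addr0 big1 ?add0r; last by move=> i _; rewrite linear0 mxE mul0r.
  exact: delta.
- rewrite eqxx mul1r big1 ?add0r; last by move=> i _; rewrite linear0 mxE mul0r.
  by rewrite /= big1 ?add0r // => b _; rewrite mul0r.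
Qed.

Lemma tapp_H p (u : P p) : cdom d p ->
  tapp (prol_anchor B rho p u) H = \sum_k prol_comp c e u k * dH_frame c e k p.
Proof.
move=> dp; rewrite {1}(prol_compE hA hB Ac Be u dp) linear_sum.
elim/big_ind2: _ => [|x x' z z' Hx Hz|k _]; first exact: tapp0.
  by rewrite tappD Hx Hz.
by rewrite linearZ tappZ tapp_frame_H.
Qed.

(** The vanishing of d eta(V_a, r) kills the components of r along X_a, and
    that of d eta(X_a, r) then kills those along V_a. *)
Lemma reeb_frame p : cdom d p -> r p = fvec F (inr tt) p.
Proof.
move=> dp; have [sr r0 r1] := hr.
have Hk k : \sum_l prol_comp c e (r p) l * deta_comp e C k l p = 0.
  have [s ss sp] := global_extension hM hB hL Ac Be (fvec F k p) dp.
  have := r0 s ss p; rewrite (deta_skew hP p sr ss) => /eqP; rewrite oppr_eq0 => /eqP.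
  rewrite (deta_formula hM hB hL hP Ac Be hC dp ss sr) sp (bigD1 k) //=.
  rewrite (prol_comp_frame hA hB rho Ac Be) // eqxx mul1r [X in _ + X]big1 ?addr0 // => l lk.
  by rewrite (prol_comp_frame hA hB rho Ac Be) // eq_sym (negbTE lk) mul0r.
have X0 a : prol_comp c e (r p) (inl (inl a)) = 0.
  by have := Hk (inl (inr a)); rewrite deta_comp_sum => /eqP; rewrite oppr_eq0 => /eqP.
have V0 a : prol_comp c e (r p) (inl (inr a)) = 0.
  have := Hk (inl (inl a)); rewrite deta_comp_sum big1 ?addr0 // => b _.
  by rewrite X0 mul0r.
apply: (prol_comp_eq hA hB Ac Be dp) => k; rewrite (prol_comp_frame hA hB rho Ac Be) //.
case: k => [[a|a]|[]]; rewrite ?X0 ?V0 //.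
have := r1 p; rewrite (eta_prol_comp hM hB Ac Be) // prol_idx_sum.
rewrite big1; last by move=> a _; rewrite X0 mul0r.
by rewrite big1 ?add0r ?mulr1 ?eqxx //; move=> a _; rewrite V0 mul0r.
Qed.

Lemma reeb_H p : cdom d p -> anchor_der (prol_anchor B rho) r H p = cpder d H idx_s p.
Proof. by move=> dp; rewrite /anchor_der reeb_frame // tapp_frame_H. Qed.

(** In the component along V_a, the order of the lower indices of C^g_ab is the
    one of d eta(X_a, xi). *)
Definition ham_comp (k : @prol_idx m) p : R :=
  match k with
  | inl (inl a) => cpder d H (idx_y a) p
  | inl (inr a) =>
      - (\sum_(i < n) rho (dr_base p) (fvec e a (dr_base p)) c 0 i * cpder d H (idx_q i) p
         + \sum_(b < m) \sum_(g < m) C g a b (dr_base p) * ycoord p e g * cpder d H (idx_y b) p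
         + ycoord p e a * cpder d H idx_s p)
  | inr _ => \sum_(a < m) ycoord p e a * cpder d H (idx_y a) p - H p
  end.

(** A condition on a single vector, in which no chart occurs. All the
    extensions s of u lead to the same condition as the exterior derivative is
    tensorial. *)
Definition ham_point p (u : P p) : Prop :=
  eta p u = - H p /\ forall s z, smooth s -> smooth z -> s p = u ->
    deta s z p = ext_d0 (prol_anchor B rho) H z p
                 - anchor_der (prol_anchor B rho) r H p * eta p (z p).

(** Evaluation on V_a gives the components along X_a, evaluation on X_a those
    along V_a, and eta the one along V_s; evaluation on V_s gives a trivial
    identity because the derivative of H along the Reeb section is its
    s-derivative. *)
Lemma ham_pointP p (u : P p) : cdom d p ->
  ham_point u <-> forall k, prol_comp c e u k = ham_comp k p.
Proof.
move=> dp.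
have Es : eta p u = prol_comp c e u (inr tt) -
    \sum_(a < m) prol_comp c e u (inl (inl a)) * ycoord p e a.
  rewrite (eta_prol_comp hM hB Ac Be) // prol_idx_sum /= mulr1 addrC; congr (_ + _).
  rewrite [X in _ + X]big1 ?addr0; last by move=> a _; rewrite mulr0.
  by rewrite -sumrN; apply: eq_bigr => a _; rewrite mulrN.
(* The equation for d eta, evaluated on the k-th vector of the frame. *)
pose cond := forall k, - (\sum_l prol_comp c e u l * deta_comp e C k l p) =
  dH_frame c e k p - cpder d H idx_s p * eta_comp e k p.
have condP : ham_point u <-> eta p u = - H p /\ cond.
  split=> -[Hu Hs]; split => //.
    move=> k; have [s ss sp] := global_extension hM hB hL Ac Be u dp.
    have [z sz zp] := global_extension hM hB hL Ac Be (fvec F k p) dp.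
    have := Hs s z ss sz sp; rewrite (deta_skew hP p ss sz).
    rewrite (deta_formula hM hB hL hP Ac Be hC dp sz ss) sp zp (bigD1 k) //=.
    rewrite (prol_comp_frame hA hB rho Ac Be) // eqxx mul1r [X in _ + X]big1 ?addr0; last first.
      by move=> l lk; rewrite (prol_comp_frame hA hB rho Ac Be) // eq_sym (negbTE lk) mul0r.
    by rewrite /ext_d0 reeb_H // {1}/anchor_der zp tapp_frame_H // (eta_frame hM hB rho Ac Be).
  move=> s z ss sz sp; rewrite (deta_skew hP p ss sz).
  rewrite (deta_formula hM hB hL hP Ac Be hC dp sz ss) sp.
  rewrite /ext_d0 reeb_H // {1}/anchor_der tapp_H // (eta_prol_comp hM hB Ac Be) //.
  rewrite -sumrN mulr_sumr -sumrB; apply: eq_bigr => k _.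
  by rewrite -mulrN Hs mulrBr; congr (_ - _); rewrite mulrCA.
have sumX a : (forall b, prol_comp c e u (inl (inl b)) = cpder d H (idx_y b) p) ->
    \sum_(b < m) prol_comp c e u (inl (inl b)) * \sum_(g < m) C g a b (dr_base p) * ycoord p e g =
    \sum_(b < m) \sum_(g < m) C g a b (dr_base p) * ycoord p e g * cpder d H (idx_y b) p.
  move=> X; apply: eq_bigr => b _; rewrite X mulr_sumr; apply: eq_bigr => g _.
  by rewrite mulrC.
split.
  move=> /condP [Hu Hk].
  have X a : prol_comp c e u (inl (inl a)) = cpder d H (idx_y a) p.
    by have := Hk (inl (inr a)); rewrite deta_comp_sum /= opprK mulr0 subr0.
  case=> [[a|a]|[]] /=; first exact: X.
  - have := Hk (inl (inl a)); rewrite deta_comp_sum /= (sumX a X) => Ek.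
    set S2 := \sum_b _ in Ek *.
    by apply: (addIr S2); rewrite -[LHS]opprK Ek; ring.
  - move: Hu; rewrite Es => /(canRL (subrK _)) Eg; apply: etrans Eg _.
    rewrite addrC; congr (_ - _).
    by apply: eq_bigr => a _; rewrite X mulrC.
move=> Hk; apply/condP; split.
  rewrite Es (Hk (inr tt)) (eq_bigr (fun a => ycoord p e a * cpder d H (idx_y a) p)).
    by rewrite /= addrAC subrr sub0r.
  by move=> a _; rewrite Hk mulrC.
case=> [[a|a]|[]]; rewrite deta_comp_sum.
- rewrite (sumX a (fun b => Hk (inl (inl b)))) (Hk (inl (inr a))) /=.
  by ring.
- by rewrite (Hk (inl (inl a))) /= opprK mulr0 subr0.
- by rewrite /= oppr0 mulr1 subrr.
Qed.

Lemma smooth_at_ham_comp p k : cdom d p ->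
  (forall g a b q, fdom e q -> smooth_at A (C g a b) q) -> smooth_at AD (ham_comp k) p.
Proof.
move=> dp sC; have [cp ep] := dp.
have sd j : smooth_at AD (cpder d H j) p.
  by apply: (smooth_at_cpder hAD) => //; exact: dr_atlas_chart.
have sy a : smooth_at AD (fun p => ycoord p e a) p by exact: (smooth_at_dr_y hM hB a Ac Be dp).
case: k => [[a|a]|[]]; first exact: sd.
- apply: (smooth_at_opp hAD); apply: (smooth_at_add hAD); last by apply: (smooth_at_mul hAD).
  apply: (smooth_at_add hAD); apply: (smooth_at_sum hAD) => i.
    apply: (smooth_at_mul hAD) => //.
    apply: (smooth_at_dr_pi hA hB (f := fun q => rho q (fvec e a q) c 0 i)).
    exact: (smooth_at_rho hA hB (la_anchor_smooth hL)).
  apply: (smooth_at_sum hAD) => g; apply: (smooth_at_mul hAD) => //; apply: (smooth_at_mul hAD) => //.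
  by apply: (smooth_at_dr_pi hA hB); exact: sC.
- apply: (smooth_at_add hAD); last by apply: (smooth_at_opp hAD).
  by apply: (smooth_at_sum hAD) => a; apply: (smooth_at_mul hAD).
Qed.

End InChart.
End HamiltonianSection.

(** * The contact Hamilton equations *)

Section TangentComponents.
Context {R : realType} {M : Type} {n : nat} {A : set (chart R M n)} {p : M}.
Implicit Types (v w : tspace A p) (c : chart R M n).

Lemma tcompD c i v w : (v + w) c 0 i = v c 0 i + w c 0 i.
Proof. by rewrite -[LHS]/((v c + w c) 0 i) mxE. Qed.

Lemma tcompZ c i k v : (k *: v) c 0 i = k * v c 0 i.
Proof. by rewrite -[LHS]/((k *: v c) 0 i) mxE. Qed.

Lemma tcomp0 c i : (0 : tspace A p) c 0 i = 0.
Proof. by rewrite -[LHS]/((0 : 'rV[R]_n) 0 i) mxE. Qed.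

End TangentComponents.

Theorem theorem5p4 (R : realType) (n m : nat)
  (Q : Type) (A : set (chart R Q n)) (hQ : is_manifold A)
  (E : Q -> lmodType R) (B : set (frame 'I_m E)) (hE : is_vector_bundle A B)
  (rho : forall q, {linear E q -> tspace A q})
  (br : section E -> section E -> section E)
  (hLA : is_lie_algebroid B rho br)
  (brP : prol_section B rho -> prol_section B rho -> prol_section B rho)
  (hP : is_prol_bracket br brP)
  (r : prol_section B rho)
  (hr : is_reeb (prol_frames B rho) (prol_anchor B rho) brP
          (contact_eta B rho) r)
  (H : dualR E -> R) (hH : smooth_fun (dr_atlas A B) setT H) :
  (exists! xi, is_hamiltonian_section brP r H xi) /\
  forall xi, is_hamiltonian_section brP r H xi ->
  forall g : R -> dualR E,
  integral_curve (fun p => prol_anchor B rho p (xi p)) g ->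
  forall (c : chart R Q n) (e : frame 'I_m E)
         (C : 'I_m -> 'I_m -> 'I_m -> Q -> R),
  A c -> B e -> structure_functions A B br e C ->
  forall t : R, cdom (dr_chart c e) (g t) ->
  let q := dr_base (g t) in
  let y a := dr_cov (g t) (fvec e a q) in
  let rhoe i a := rho q (fvec e a q) c 0 i in
  let dH k := cpder (dr_chart c e) H k (g t) in
  [/\ forall i : 'I_n,
        is_derive (t : R) (1 : R)
          (fun t' : R => cmap c (dr_base (g t')) 0 i : R)
          (\sum_(a < m) rhoe i a * dH (idx_y a)),
      forall a : 'I_m,
        is_derive (t : R) (1 : R)
          (fun t' : R => dr_cov (g t') (fvec e a (dr_base (g t'))) : R)
          (- (\sum_(i < n) rhoe i a * dH (idx_q i)
              + \sum_(b < m) \sum_(k < m) C k a b q * y k * dH (idx_y b)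
              + y a * dH idx_s))
    & is_derive (t : R) (1 : R) (fun t' : R => dr_s (g t') : R)
        (\sum_(a < m) y a * dH (idx_y a) - H (g t))].
Proof.
have hA := manifold_atlas hQ; have hB := vector_bundle_frames hE.
have hAD := dr_smooth_atlas hA hB.
have hBP := prol_smooth_frames hA hB (la_anchor_smooth hLA).
have chartP p : exists c e C, [/\ A c, B e, cdom (dr_chart c e) p,
    structure_functions A B br e C &
    forall k a b q, fdom e q -> smooth_at A (C k a b) q].
  have [c Ac cp] := atlas_cover hA (dr_base p).
  have [e Be ep] := fr_cover hB (dr_base p).
  have [C [hC sC]] := structure_functions_exist hQ hB hLA Be.
  by exists c, e, C.
pose ham := @ham_point R n m Q E A B rho brP r H.
(* As d eta is tensorial, the defining equation is a pointwise condition. *)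
have ham_iff xi : is_hamiltonian_section brP r H xi <->
    smooth_section (dr_atlas A B) (prol_frames B rho) setT xi /\ forall p, ham p (xi p).
  split=> [[sxi Heta Hdeta]|[sxi Hxi]].
    split=> // p; split; first exact: Heta.
    have [c [e [C [Ac Be dp hC _]]]] := chartP p.
    move=> s z ss sz sp; rewrite -Hdeta //.
    rewrite (deta_formula hQ hB hLA hP Ac Be hC dp ss sz).
    by rewrite (deta_formula hQ hB hLA hP Ac Be hC dp sxi sz) sp.
  split=> // [p|z sz p]; first exact: (Hxi p).1.
  exact: ((Hxi p).2 xi z sxi sz).
have ham_unique p u w : ham p u -> ham p w -> u = w.
  have [c [e [C [Ac Be dp hC _]]]] := chartP p.
  move=> /(ham_pointP hQ hB hLA hP hr hH Ac Be hC u dp) Hu.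
  move=> /(ham_pointP hQ hB hLA hP hr hH Ac Be hC w dp) Hw.
  by apply: (prol_comp_eq hA hB Ac Be dp) => k; rewrite Hu Hw.
have ham_exists p : exists u, ham p u.
  have [c [e [C [Ac Be dp hC _]]]] := chartP p.
  exists (\sum_k ham_comp rho H c e C k p *: fvec (prol_frame B rho c e) k p).
  apply/(ham_pointP hQ hB hLA hP hr hH Ac Be hC _ dp) => k.
  by rewrite (prol_comp_sum hA hB rho Ac Be).
split.
  pose xi p := projT1 (cid (ham_exists p)).
  have ham_xi p : ham p (xi p) by exact: (projT2 (cid (ham_exists p))).
  exists xi; split.
    apply/ham_iff; split => //; apply/(global_sectionP hAD hBP) => p.
    have [c [e [C [Ac Be dp hC sC]]]] := chartP p.
    have PF : prol_frames B rho (prol_frame B rho c e) by exists c, e.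
    apply: (section_smooth_at_intro hAD hBP PF dp) => k.
    apply: (smooth_at_eq hAD (f := ham_comp rho H c e C k)); last first.
      exact: (smooth_at_ham_comp hQ hB hLA hH).
    apply: mnearS (mnear_chart hA hB Ac Be dp) => p' dp'.
    rewrite (fcoord_prol hA hB Ac Be) //.
    by move/(ham_pointP hQ hB hLA hP hr hH Ac Be hC _ dp'): (ham_xi p') => ->.
  move=> xi' /ham_iff [_ Hxi']; apply: functional_extensionality_dep => p.
  exact: ham_unique.
move=> xi /ham_iff [_ Hxi] g Hg c e C Ac Be hC t dt q y rhoe dH.
have Hx := (ham_pointP hQ hB hLA hP hr hH Ac Be hC _ dt).1 (Hxi (g t)).
have [_ Hd] := Hg t _ (dr_atlas_chart Ac Be) dt.
have Xc a : fcoord e (pval (xi (g t))).1 a = dH (idx_y a) := Hx (inl (inl a)).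
split.
- move=> i; have := Hd (idx_q i).
  rewrite (_ : (fun t' : R => _) = (fun t' : R => cmap c (dr_base (g t')) 0 i)); last first.
    by apply/funext => t'; rewrite dr_chart_q.
  move=> Hi; apply: is_derive_eq.
  rewrite -[prol_anchor _ _ _ _]/(pval (xi (g t))).2 (prol_anchor_q hA hB _ _ Ac Be dt).
  have [_ et] := dt.
  rewrite (fcoordE (fr_frame hB Be) (pval (xi (g t))).1 et) linear_sum.
  rewrite (big_morph (fun v : tspace A (dr_pi (g t)) => v c 0 i) (id1 := 0)
    (op1 := +%R)) => [|v w|]; [|exact: tcompD|exact: tcomp0].
  by apply: eq_bigr => a _; rewrite linearZ tcompZ Xc mulrC.
- move=> a; have := Hd (idx_y a).
  rewrite (_ : (fun t' : R => _) =
    (fun t' : R => dr_cov (g t') (fvec e a (dr_base (g t'))))); last first.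
    by apply/funext => t'; rewrite dr_chart_y.
  move=> Ha; apply: is_derive_eq.
  exact: (Hx (inl (inr a))).
- have := Hd idx_s.
  rewrite (_ : (fun t' : R => _) = (fun t' : R => dr_s (g t'))); last first.
    by apply/funext => t'; rewrite dr_chart_s.
  move=> Hs; apply: is_derive_eq.
  exact: (Hx (inr tt)).
Qed.
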